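(* Let $N\ge2$ and $0\ne q\in k$ with $[n]_q:=1+q+\cdots+q^{n-1}\ne0$ for all $n\ge1$. Let $V$ be a finite-dimensional vector superspace and $\mathscr R\colon V^{\otimes2}\to V^{\otimes2}$ a Hecke operator associated with $q$. Then the $N$-homogeneous superalgebra $\Lambda_{\mathscr R,N}=\mathsf T(V)/(R)$, with $R=\operatorname{Im}\rho_{N,\mathscr R}(X_N)\subseteq V^{\otimes N}$, is $N$-Koszul.
   Context: $k$ a field, $\operatorname{char}k\ne2$; vector superspaces with sign conventions. A Hecke operator associated with $q$ is an even linear map $\mathscr R\colon V^{\otimes2}\to V^{\otimes2}$ with $(\mathscr R+1)(\mathscr R-q)=0$ and $\mathscr R_1\mathscr R_2\mathscr R_1=\mathscr R_2\mathscr R_1\mathscr R_2$ where $\mathscr R_1=\mathscr R\otimes\mathrm{Id}_V$, $\mathscr R_2=\mathrm{Id}_V\otimes\mathscr R$. The Hecke algebra $\mathscr H_{n,q}$ is generated by $T_1,\dots,T_{n-1}$ with $(T_i+1)(T_i-q)=0$, $T_iT_{i+1}T_i=T_{i+1}T_iT_{i+1}$, $T_iT_j=T_jT_i$ for $|i-j|\ge2$; for $\sigma\in\mathfrak S_n$ with reduced expression $\sigma=\sigma_{i_1}\cdots\sigma_{i_r}$ ($\sigma_i=(i,i+1)$) put $T_\sigma=T_{i_1}\cdots T_{i_r}$. The $q$-symmetrizer is $X_n=\frac1{[n]_q!}\sum_{\sigma\in\mathfrak S_n}T_\sigma$, $[n]_q!=\prod_{i=1}^n[i]_q$. The representation $\rho_{n,\mathscr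 R}\colon\mathscr H_{n,q}\to\operatorname{End}(V^{\otimes n})$ is $\rho(T_i)=\mathrm{Id}_V^{\otimes(i-1)}\otimes\mathscr R\otimes\mathrm{Id}_V^{\otimes(n-i-1)}$. A connected graded algebra $\mathcal A$ (here graded by tensor degree) is $N$-Koszul if $\operatorname{Tor}^{\mathcal A}_i(k,k)$ is concentrated in degree $\nu_N(i)$ for all $i\ge0$, where $\nu_N(i)=\frac i2N$ for $i$ even and $\frac{i-1}2N+1$ for $i$ odd. *)

(* Defs.v *)
From HB Require Import structures.
From mathcomp Require Import all_boot all_order all_algebra all_fingroup.
Set Implicit Arguments. Unset Strict Implicit. Unset Printing Implicit Defensive.
Import GRing.Theory.
Local Open Scope ring_scope.

Section Koszul.
Variable k : fieldType.

(* Tensor powers of V = k^n with the standard basis e_0..e_(n-1).      *)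
(* V^{(x)m} has basis the words w of length m over 'I_n; a vector is  *)
(* its coordinate function.                                            *)
Definition TV (n m : nat) := {ffun m.-tuple 'I_n -> k^o}.

Definition deltaS (n a : nat) (u : seq 'I_n) : TV n a :=
  [ffun t : a.-tuple 'I_n => ((val t == u)%:R : k^o)].

Definition coefS (n a : nat) (F : 'End(TV n a)) (u v : seq 'I_n) : k^o :=
  \sum_(t : a.-tuple 'I_n | val t == v) F (deltaS a u) t.

Definition coordS (n a : nat) (r : TV n a) (v : seq 'I_n) : k^o :=
  \sum_(t : a.-tuple 'I_n | val t == v) r t.

Definition window (n p a : nat) (w : seq 'I_n) := take a (drop p w).
Definition agree (n p a : nat) (w w' : seq 'I_n) :=
  (take p w == take p w') && (drop (p + a) w == drop (p + a) w').

(* Id^{(x)p} (x) F (x) Id^{(x)(m-p-a)} acting on V^{(x)m}  (no Koszul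
   signs appear since all maps involved are even) *)
Definition liftop (n a : nat) (F : 'End(TV n a)) (m p : nat) : 'End(TV n m) :=
  linfun (fun f : TV n m =>
    [ffun w : m.-tuple 'I_n =>
       \sum_(w' : m.-tuple 'I_n | agree p a w' w)
          f w' * coefS F (window p a w') (window p a w)]).

(* Super structure: V = k^{n0|n-n0}, e_i even iff i < n0.              *)
Definition wpar (n n0 : nat) (w : seq 'I_n) : bool :=
  odd (count (fun x : 'I_n => n0 <= x)%N w).

Definition even_op (n n0 a : nat) (F : 'End(TV n a)) : Prop :=
  forall u v : a.-tuple 'I_n,
    F (deltaS a u) v != 0 -> wpar n0 u = wpar n0 v.

Definition hecke_op (n n0 : nat) (q : k) (R : 'End(TV n 2)) : Prop :=
  [/\ even_op n0 R,
      ((R + \1%VF) \o (R - q *: \1%VF) = 0)%VF &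
      (liftop R 3 0 \o liftop R 3 1 \o liftop R 3 0 =
       liftop R 3 1 \o liftop R 3 0 \o liftop R 3 1)%VF].

Definition qint (q : k) (m : nat) : k := \sum_(j < m) q ^+ j.
Definition qfact (q : k) (m : nat) : k := \prod_(j < m) qint q j.+1.

(* the simple transposition sigma_(i+1) = (i+1, i+2) of {1..N},
   i.e. swapping the 0-based positions i and i+1 *)
Definition sPerm (N i : nat) : {perm 'I_N} :=
  match N return {perm 'I_N} with
  | 0 => 1%g
  | N'.+1 => tperm (inord i : 'I_N'.+1) (inord i.+1)
  end.

(* sigma_(i_1) ... sigma_(i_r) as a composition of maps (applied right to
   left); in MathComp (s * t) x = t (s x), hence the rev *)
Definition permOfWord (N : nat) (w : seq nat) : {perm 'I_N} :=
  (\prod_(i <- rev w) sPerm N i)%g.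

Definition perm_len (N : nat) (s : {perm 'I_N}) : nat :=
  #|[set p : 'I_N * 'I_N | (p.1 < p.2)%N && (s p.2 < s p.1)%N]|.

(* rho(T_i) = Id^{(x)(i-1)} (x) R (x) Id, for i = j+1, j 0-based *)
Definition rhoT (n N : nat) (R : 'End(TV n 2)) (j : nat) : 'End(TV n N) :=
  liftop R N j.

(* rho(T_sigma) = rho(T_(i_1)) ... rho(T_(i_r)) for a reduced expression
   sigma = sigma_(i_1) ... sigma_(i_r) (a reduced expression is a word of
   length perm_len sigma; one is picked) *)
Definition rhoTsigma (n N : nat) (R : 'End(TV n 2)) (s : {perm 'I_N}) :
    'End(TV n N) :=
  match [pick t : (perm_len s).-tuple 'I_N.-1 |
           permOfWord N (map val t) == s] with
  | Some t => foldr (fun i acc => (rhoT N R i \o acc)%VF) \1%VF (map val t)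
  | None => \1%VF
  end.

Definition rhoX (n N : nat) (q : k) (R : 'End(TV n 2)) : 'End(TV n N) :=
  (qfact q N)^-1 *: \sum_(s : {perm 'I_N}) rhoTsigma R s.

Definition relX (n N : nat) (q : k) (R : 'End(TV n 2)) : {vspace TV n N} :=
  limg (rhoX N q R).

(* Tor^A_i(k,k) for A = T(V)/(Rel), Rel in V^{(x)N}, via the normalized *)
(* bar complex  Tor_i = H_i(A_+^{(x)i}),                                *)
(*   d(a_1|...|a_i) = sum_{j=1}^{i-1} (-1)^j a_1|..|a_j a_(j+1)|..|a_i. *)
(* In internal degree d, A_+^{(x)i} = (+)_{c} A_(c_1) (x)..(x) A_(c_i)  *)
(* over compositions c of d into i positive parts, and                  *)
(* A_(c_1)(x)..(x)A_(c_i) = V^{(x)d} / J_c, J_c the sum of the          *)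
(* V^{(x)p} (x) Rel (x) V^{(x)(d-p-N)} whose window [p,p+N) lies inside  *)
(* one block of c.  A composition is encoded by its set of block        *)
(* starting positions c (a subset of 'I_d containing 0, of size i).    *)
(* Everything lives in the ambient space Amb d with basis (c, w).       *)
Definition Amb (n d : nat) := {ffun {set 'I_d} * d.-tuple 'I_n -> k^o}.

Definition deltaB (n d : nat) (x : {set 'I_d} * d.-tuple 'I_n) : Amb n d :=
  [ffun y => ((y == x)%:R : k^o)].

Definition validc (d i : nat) (c : {set 'I_d}) : bool :=
  (#|c| == i) && [forall x : 'I_d, (val x == 0%N) ==> (x \in c)].

(* chains of bar degree i, internal degree d (lifted to V^{(x)d}) *)
Definition Ch (n i d : nat) : {vspace Amb n d} :=
  (\sum_(x : {set 'I_d} * d.-tuple 'I_n | validc i x.1) <[deltaB x]>)%VS.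

(* bar differential: removing the start b of block j+1 merges blocks
   j and j+1, with sign (-1)^j, j = #{ y in c | y < b } *)
Definition barD (n d : nat) : 'End(Amb n d) :=
  linfun (fun f : Amb n d =>
    [ffun x : {set 'I_d} * d.-tuple 'I_n =>
       \sum_(b : 'I_d | (b \notin x.1) && (val b != 0%N))
          (-1) ^+ #|[set y in x.1 | (y < b)%N]| * f (b |: x.1, x.2)]).

Definition inblock (d N : nat) (c : {set 'I_d}) (p : nat) : bool :=
  [forall b : 'I_d, (b \in c) ==> ~~ ((p < b) && (b < p + N))%N].

(* the generator e_c (x) (e_u (x) r (x) e_v), with u = take p w0,
   v = drop (p+N) w0 *)
Definition Jgen (n N d : nat) (c : {set 'I_d}) (p : nat) (w0 : d.-tuple 'I_n)
    (r : TV n N) : Amb n d :=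
  [ffun x : {set 'I_d} * d.-tuple 'I_n =>
     if (x.1 == c) && agree p N x.2 w0 then coordS r (window p N x.2) else 0].

Definition Jrel (n N : nat) (Rel : {vspace TV n N}) (i d : nat) :
    {vspace Amb n d} :=
  (\sum_(c : {set 'I_d} | validc i c)
     \sum_(p < d.+1 | ((p + N <= d)%N && inblock N c p))
       \sum_(w0 : d.-tuple 'I_n)
         \sum_(r <- vbasis Rel) <[Jgen c p w0 r]>)%VS.

Definition cyc (n N : nat) (Rel : {vspace TV n N}) (i d : nat) :=
  (Ch n i d :&: (barD n d @^-1: Jrel Rel i.-1 d))%VS.
Definition bnd (n N : nat) (Rel : {vspace TV n N}) (i d : nat) :=
  (barD n d @: Ch n i.+1 d + Jrel Rel i d)%VS.

Definition torDim (n N : nat) (Rel : {vspace TV n N}) (i d : nat) : nat :=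
  (\dim (cyc Rel i d) - \dim (bnd Rel i d))%N.

Definition nuN (N i : nat) : nat :=
  if odd i then (i./2 * N + 1)%N else (i./2 * N)%N.

Definition NKoszul (n N : nat) (Rel : {vspace TV n N}) : Prop :=
  forall i d : nat, d != nuN N i -> torDim Rel i d = 0%N.

End Koszul.

(* Main.v *)
Require Import Defs.
From HB Require Import structures.
From mathcomp Require Import all_boot all_order all_algebra all_fingroup.
From mathcomp Require Import zify ring.
Set Implicit Arguments. Unset Strict Implicit. Unset Printing Implicit Defensive.
Import GRing.Theory.
Local Open Scope ring_scope.

(** Write E_l for the q-eigenspace of T_l in a Hecke module M and E_D for the
    intersection of the E_l, l in D.  On M = V^{(x)d} each space of relations
    V^{(x)p} (x) R (x) V^{(x)(d-p-N)} is some E_D with D an interval of N-1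
    generators, so everything follows from the distributivity
    E_D n (E_(D_1) + ... + E_(D_r)) = E_(D u D_1) + ... + E_(D u D_r).

    Distributivity is easy for the coinduced module C(M) of functions on the
    symmetric group with values in M: after rescaling by q^length, E_D consists
    of the functions invariant under the reflections of D, and the indicator
    functions of Bruhat intervals [1, w] form a unitriangular family adapted to
    all the E_l at once.  A general M embeds in C(M) by v |-> (w |-> T_w v), and
    M |-> E_D(M) is exact because the q-symmetrizers exist, so the statement for
    M and r subspaces follows from the one for the cokernel C(M) / M and fewer
    subspaces.

    In the bar complex, indexed by the sets of cuts of a composition of d, toggling
    the cuts 1, 2, ..., d-1 in turn and using distributivity moves any cycle into
    the intersection of all the E_l.  There the complex becomes the bar complex of
    k[x]/(x^N), and toggling the cuts 1, N+1, 2N+1, ... leaves only the composition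
    1 + (N-1) + 1 + (N-1) + ..., which lives in degree nu_N(i). *)

(** * Lengths and reduced words of permutations *)

Ltac nat_cases := repeat match goal with |- context [?a == ?b] =>
  lazymatch a with context [if _ then _ else _] => fail | _ => case: (a =P b) => ? end end.

Section Perm.
Variable m : nat.
Implicit Types (w : {perm 'I_m.+1}) (l : nat) (t : seq nat).

Local Notation s := (sPerm m.+1).
(** Since [(s l * w) x = w (s l x)], left multiplication by [s l] exchanges the entries at positions
    [l] and [l.+1] of the one-line notation of [w]. At an ascent this raises the length by one. *)
Definition ascent l w := (w (inord l) < w (inord l.+1))%N.

Lemma sPermE l (x : 'I_m.+1) : (l < m)%N ->
  s l x = (if x == l :> nat then l.+1 else if x == l.+1 :> nat then l else x) :> nat.
Proof.
move=> lm; rewrite /sPerm permE /= -!val_eqE /= !inordK //; last by lia.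
by case: ifP => _; rewrite ?inordK //; case: ifP; rewrite ?inordK //; lia.
Qed.

Lemma sPermK l : (l < m)%N -> (s l * s l = 1)%g.
Proof. by move=> lm; rewrite /sPerm tperm2. Qed.

Lemma sPerm_mulK l w : (s l * (s l * w) = w)%g.
Proof. by rewrite mulgA /sPerm tperm2 mul1g. Qed.

Lemma sPermL l : (s l (inord l) = inord l.+1).
Proof. by rewrite /sPerm tpermL. Qed.
Lemma sPermR l : (s l (inord l.+1) = inord l).
Proof. by rewrite /sPerm tpermR. Qed.

Lemma sPerm_far l (x : nat) : (l < m)%N -> (x <= m)%N -> x != l -> x != l.+1 ->
  s l (inord x) = inord x.
Proof.
by move=> lm xm x1 x2; apply: val_inj; rewrite /= sPermE //= inordK // (negbTE x1) (negbTE x2).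
Qed.

Lemma inord_neq l : (l < m)%N -> (inord l : 'I_m.+1) != inord l.+1.
Proof. by move=> lm; rewrite -val_eqE /= !inordK; lia. Qed.

Lemma ascent_sPerm l w : (l < m)%N -> ascent l (s l * w) = ~~ ascent l w.
Proof.
move=> lm; rewrite /ascent !permM sPermL sPermR.
have : w (inord l) != w (inord l.+1) by rewrite (inj_eq perm_inj) inord_neq.
by rewrite -val_eqE /=; lia.
Qed.

(** Applying [s l] to both positions matches the inversions of [w] with those of [s l * w], except
    for the pair of positions [l], [l.+1], which is an inversion of the product only. *)
Lemma perm_len_ascent l w : (l < m)%N -> ascent l w ->
  perm_len (s l * w) = (perm_len w).+1.
Proof.
move=> lm up; rewrite /perm_len.
set A := [set _ | _]; set B := [set _ | _].
pose h (p : 'I_m.+1 * 'I_m.+1) := (s l p.1, s l p.2).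
have hK : involutive h.
  by move=> [a b]; rewrite /h /= -!permM sPermK // !perm1.
suff -> : A = (inord l, inord l.+1) |: h @^-1: B.
  rewrite cardsU1 (card_preimset _ (inv_inj hK)) !inE /= sPermL sPermR.
  by rewrite !inordK ?ltnn //; lia.
apply/setP=> -[a b]; rewrite !inE /= !permM.
have [[-> ->]|neq] := eqVneq (a, b) (inord l, inord l.+1).
  rewrite sPermL sPermR /=; move: up; rewrite /ascent => ->.
  by rewrite !inordK; lia.
rewrite /=; case Hw: (w (s l b) < w (s l a))%N; rewrite ?andbF ?andbT //.
have ab : ~ (val a = l /\ val b = l.+1).
  move=> [ea eb]; case/eqP: neq; congr pair; apply: val_inj; rewrite /= inordK //; lia.
have ba : ~ (val a = l.+1 /\ val b = l).
  move=> [ea eb]; move: Hw up; rewrite /ascent.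
  have -> : a = inord l.+1 by apply: val_inj; rewrite /= inordK //; lia.
  have -> : b = inord l by apply: val_inj; rewrite /= inordK //; lia.
  by rewrite sPermL sPermR; lia.
rewrite !sPermE //=; move: ab ba => /=; do ?[case: eqP => ?]; lia.
Qed.

Lemma perm_len_descent l w : (l < m)%N -> ~~ ascent l w ->
  perm_len w = (perm_len (s l * w)).+1.
Proof.
by move=> lm dn; rewrite -[in LHS](sPerm_mulK l w) perm_len_ascent // ascent_sPerm.
Qed.

(** The values grow by at least one per position, so the bounds 0 and [m] at the two ends determine
    all of them. *)
Lemma no_descent w : (forall l, (l < m)%N -> ascent l w) -> w = 1%g.
Proof.
move=> up.
have mono i j : (i + j <= m)%N -> (w (inord i) + j <= w (inord (i + j)))%N.
  elim: j => [|j IH] ij; first by rewrite !addn0.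
  have := up (i + j)%N; rewrite /ascent addnS => /(_ ltac:(lia)).
  by rewrite !addnS; have := IH ltac:(lia); lia.
apply/permP=> x; rewrite perm1; apply: val_inj => /=.
have := mono 0%N x; rewrite add0n inord_val.
have := mono x (m - x)%N; rewrite subnKC ?inord_val -ltnS //.
have := ltn_ord (w (inord m)); have := ltn_ord x.
by move=> ? ? /(_ ltac:(lia)) ? /(_ ltac:(lia)); lia.
Qed.

Definition inrange t := all (fun l => l < m)%N t.
Definition reduced t := inrange t && (size t == perm_len (permOfWord m.+1 t)).

Lemma permOfWord_rcons t l : permOfWord m.+1 (rcons t l) = (s l * permOfWord m.+1 t)%g.
Proof. by rewrite /permOfWord rev_rcons big_cons. Qed.

Lemma perm_len1 : perm_len (1%g : {perm 'I_m.+1}) = 0%N.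
Proof. apply/eqP; rewrite cards_eq0; apply/eqP/setP=> -[a b].
by rewrite !inE !perm1 /=; case: ltngtP.
 Qed.

Lemma perm_len_word t : inrange t -> (perm_len (permOfWord m.+1 t) <= size t)%N.
Proof.
elim/last_ind: t => [|t l IH]; first by rewrite /permOfWord big_nil perm_len1.
rewrite /inrange all_rcons => /andP[lm /IH]; rewrite permOfWord_rcons size_rcons.
have [up|dn] := boolP (ascent l (permOfWord m.+1 t)).
  by rewrite perm_len_ascent //; lia.
by move: (perm_len_descent lm dn); lia.
Qed.

Lemma reduced_rcons t l : (l < m)%N ->
  reduced (rcons t l) = reduced t && ascent l (permOfWord m.+1 t).
Proof.
move=> lm; rewrite /reduced {1}/inrange all_rcons lm /= -/(inrange t) size_rcons permOfWord_rcons.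
have [ir|//] := boolP (inrange t); rewrite /=.
have := perm_len_word ir.
have [up|dn] := boolP (ascent l (permOfWord m.+1 t)).
  by rewrite perm_len_ascent // andbT eqSS.
rewrite andbF (perm_len_descent lm dn) => le; apply/negbTE/eqP => E; move: le; rewrite -E; lia.
Qed.

Lemma reduced_exists w : exists2 t, reduced t & permOfWord m.+1 t = w.
Proof.
elim: {w}(perm_len w) {-2}w (leqnn (perm_len w)) => [|n IH] w hw.
  have -> : w = 1%g.
    apply: no_descent => l lm; apply/negPn/negP => /(perm_len_descent lm); lia.
  by exists [::]; rewrite /reduced /permOfWord big_nil ?perm_len1.
have [/forallP up|/forallPn[l dn]] := boolP [forall l : 'I_m, ascent l w].
  have -> : w = 1%g by apply: no_descent => l lm; exact: (up (Ordinal lm)).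
  by exists [::]; rewrite /reduced /permOfWord big_nil ?perm_len1.
have len := perm_len_descent (ltn_ord l) dn.
have [t rt tE] := IH (s l * w)%g ltac:(lia).
exists (rcons t l); last by rewrite permOfWord_rcons tE sPerm_mulK.
by rewrite reduced_rcons // rt tE ascent_sPerm.
Qed.

End Perm.

(** * Braid relations, Hecke modules and Matsumoto's theorem *)

Section Braid.
Variable m : nat.
Implicit Types (w : {perm 'I_m.+1}) (l : nat) (t : seq nat).
Local Notation s := (sPerm m.+1).

Lemma sPerm_comm i j : (i.+1 < j)%N -> (j < m)%N -> (s i * s j = s j * s i)%g.
Proof.
move=> ij jm; have im : (i < m)%N by lia.
apply/permP=> x; rewrite !permM; apply: val_inj; rewrite /= !sPermE //.
nat_cases; lia.
Qed.

Lemma sPerm_braid i : (i.+1 < m)%N -> (s i * s i.+1 * s i = s i.+1 * s i * s i.+1)%g.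
Proof.
move=> jm; have im : (i < m)%N by lia.
apply/permP=> x; rewrite !permM; apply: val_inj; rewrite /= !sPermE //=.
nat_cases; lia.
Qed.

Lemma ascent_far i j w : (i.+1 < j)%N || (j.+1 < i)%N -> (i < m)%N -> (j < m)%N ->
  ascent j (s i * w)%g = ascent j w.
Proof. by move=> far im jm; rewrite /ascent !permM !sPerm_far //; lia. Qed.

(* In one-line notation the three consecutive values decrease. *)
Lemma descent_braid i w : (i.+1 < m)%N -> ~~ ascent i w -> ~~ ascent i.+1 w ->
  [/\ ~~ ascent i.+1 (s i * w)%g, ~~ ascent i (s i.+1 * (s i * w))%g,
      ~~ ascent i (s i.+1 * w)%g & ~~ ascent i.+1 (s i * (s i.+1 * w))%g].
Proof.
move=> im; rewrite /ascent -!leqNgt => d1 d2.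
have e1 : s i (inord i.+2) = inord i.+2 by apply: sPerm_far; lia.
have e2 : s i.+1 (inord i) = inord i by apply: sPerm_far; lia.
by split; rewrite !permM ?sPermL ?sPermR ?e1 ?e2 ?sPermL ?sPermR ?e1 ?e2 //; lia.
Qed.

End Braid.

Section Hecke.
Variables (k : fieldType) (m : nat) (q : k).

Definition hecke_module (X : vectType k) (T : nat -> 'End(X)) :=
  [/\ forall l, (l < m)%N -> forall v, T l (T l v) = (q - 1) *: T l v + q *: v,
      forall l, (l.+1 < m)%N ->
        forall v, T l (T l.+1 (T l v)) = T l.+1 (T l (T l.+1 v)) &
      forall i j, (i.+1 < j)%N -> (j < m)%N -> forall v, T i (T j v) = T j (T i v)].

Section Module.
Variables (X : vectType k) (T : nat -> 'End(X)).

Definition word_op (t : seq nat) : 'End(X) :=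
  foldr (fun i acc => (T i \o acc)%VF) \1%VF t.

Lemma word_op_rcons t l v : word_op (rcons t l) v = word_op t (T l v).
Proof.
elim: t => [|a t IH] /=; first by rewrite comp_lfunE !id_lfunE.
by rewrite !comp_lfunE IH.
Qed.

Definition eigen (D : pred nat) (v : X) :=
  forall l, (l < m)%N -> D l -> T l v = q *: v.

Hypothesis hT : hecke_module T.

(** Matsumoto's theorem, by induction on the length. If the last letters [i] and [j] differ, both
    are descents of the permutation, which therefore has reduced words ending in either form of the
    longest element of the subgroup generated by [s i] and [s j]. One commutation or braid relation
    passes between these two forms. *)
Lemma word_op_reduced t t' : reduced m t -> reduced m t' ->
  permOfWord m.+1 t = permOfWord m.+1 t' -> word_op t =1 word_op t'.
Proof.
have [_ braid comm] := hT.
elim: {t}(size t) {-2}t t' (erefl (size t)) => [|n IH] t t' st rt rt' E v.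
  have st' : size t' = 0%N.
    by case/andP: rt rt' => _ /eqP e /andP[_ /eqP]; rewrite -E -e st.
  by rewrite (size0nil st) (size0nil st').
have step i j u u' : (i < j)%N -> size u = n -> size u' = n -> (i < m)%N -> (j < m)%N ->
    reduced m (rcons u i) -> reduced m (rcons u' j) ->
    permOfWord m.+1 (rcons u i) = permOfWord m.+1 (rcons u' j) ->
    word_op (rcons u i) v = word_op (rcons u' j) v.
  move=> ij su su' im jm; rewrite !reduced_rcons // => /andP[ru ui] /andP[ru' uj].
  rewrite !permOfWord_rcons !word_op_rcons => Eij.
  pose w := (sPerm m.+1 i * permOfWord m.+1 u)%g.
  have wi : ~~ ascent i w by rewrite ascent_sPerm // ui.
  have wj : ~~ ascent j w by rewrite /w Eij ascent_sPerm // uj.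
  have uE : permOfWord m.+1 u = (sPerm m.+1 i * w)%g by rewrite sPerm_mulK.
  have uE' : permOfWord m.+1 u' = (sPerm m.+1 j * w)%g by rewrite /w Eij sPerm_mulK.
  have [far|near] := ltnP i.+1 j.
    have [x rx xE] := reduced_exists (sPerm m.+1 j * (sPerm m.+1 i * w))%g.
    have rj : reduced m (rcons x j).
      by rewrite reduced_rcons // rx xE ascent_sPerm // ascent_far ?far.
    have ri : reduced m (rcons x i).
      rewrite reduced_rcons // rx xE mulgA -sPerm_comm // -mulgA.
      by rewrite ascent_sPerm // ascent_far ?far ?orbT.
    rewrite (IH u _ su ru rj); last by rewrite permOfWord_rcons xE sPerm_mulK uE.
    rewrite (IH u' _ su' ru' ri); last first.
      by rewrite permOfWord_rcons xE mulgA -mulgA [in RHS]mulgA sPerm_comm // -mulgA sPerm_mulK uE'.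
    by rewrite !word_op_rcons (comm i j).
  have jE : j = i.+1 by lia.
  subst j; have [b1 b2 b3 b4] := descent_braid jm wi wj.
  (* The word [x] spells what is left of [w] once the longest element of the subgroup generated by
     [s i] and [s i.+1] is removed. *)
  have [x rx xE] :=
    reduced_exists (sPerm m.+1 i * (sPerm m.+1 i.+1 * (sPerm m.+1 i * w)))%g.
  have xE' : permOfWord m.+1 x =
      (sPerm m.+1 i.+1 * (sPerm m.+1 i * (sPerm m.+1 i.+1 * w)))%g.
    by rewrite xE !mulgA sPerm_braid.
  have ri : reduced m (rcons (rcons x i) i.+1).
    rewrite !reduced_rcons // rx permOfWord_rcons xE sPerm_mulK /=.
    by rewrite !ascent_sPerm // b1 b2.
  have rj : reduced m (rcons (rcons x i.+1) i).
    rewrite !reduced_rcons // rx permOfWord_rcons xE' sPerm_mulK /=.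
    by rewrite !ascent_sPerm // b3 b4.
  rewrite (IH u _ su ru ri); last by rewrite !permOfWord_rcons xE !sPerm_mulK uE.
  rewrite (IH u' _ su' ru' rj); last by rewrite !permOfWord_rcons xE' !sPerm_mulK uE'.
  by rewrite !word_op_rcons braid.
have st' : size t' = n.+1.
  by case/andP: rt rt' => _ /eqP e /andP[_ /eqP]; rewrite -E -e => ->.
case/lastP: t st rt E => // t i; case/lastP: t' st' rt' => // t' j.
rewrite !size_rcons => -[st'] rt' [st] rt E.
have im : (i < m)%N by case/andP: rt; rewrite /inrange all_rcons => /andP[].
have jm : (j < m)%N by case/andP: rt'; rewrite /inrange all_rcons => /andP[].
have [ij|ij|ij] := ltngtP i j; first exact: step.
  by apply/esym/step.
subst j; rewrite !word_op_rcons; apply: IH => //.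
- by move: rt; rewrite reduced_rcons // => /andP[].
- by move: rt'; rewrite reduced_rcons // => /andP[].
by move: E; rewrite !permOfWord_rcons => /mulgI.
Qed.

Lemma reduced_word_subproof (w : {perm 'I_m.+1}) :
  exists t, reduced m t && (permOfWord m.+1 t == w).
Proof. by have [t rt /eqP tE] := reduced_exists w; exists t; rewrite rt tE. Qed.

Definition perm_op (w : {perm 'I_m.+1}) : 'End(X) :=
  word_op (xchoose (reduced_word_subproof w)).

Lemma perm_op_word t w : reduced m t -> permOfWord m.+1 t = w ->
  word_op t =1 perm_op w.
Proof.
have /andP[r /eqP E] := xchooseP (reduced_word_subproof w).
by move=> rt tE; apply: word_op_reduced => //; rewrite tE E.
Qed.

Lemma perm_op1 v : perm_op 1%g v = v.
Proof.
rewrite -(@perm_op_word [::]) ?id_lfunE // /reduced /permOfWord big_nil //.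
by rewrite perm_len1.
Qed.

Lemma perm_op_ascent w l v : (l < m)%N -> ascent l w ->
  perm_op w (T l v) = perm_op (sPerm m.+1 l * w)%g v.
Proof.
move=> lm up; have [t rt tE] := reduced_exists w.
rewrite -(perm_op_word rt tE) -word_op_rcons; apply: perm_op_word.
  by rewrite reduced_rcons // rt tE.
by rewrite permOfWord_rcons tE.
Qed.

Lemma perm_op_descent w l v : (l < m)%N -> ~~ ascent l w ->
  perm_op w (T l v) = (q - 1) *: perm_op w v + q *: perm_op (sPerm m.+1 l * w)%g v.
Proof.
have [quad _ _] := hT.
move=> lm dn; have up : ascent l (sPerm m.+1 l * w)%g by rewrite ascent_sPerm.
have E u : perm_op w u = perm_op (sPerm m.+1 l * w)%g (T l u).
  by rewrite perm_op_ascent // sPerm_mulK.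
by rewrite !E quad // linearD !linearZ.
Qed.

End Module.
End Hecke.

(** * q-symmetrizers *)

(** Reduces identities between vectors to identities between scalars, which [ring] decides. *)
Lemma scalar_separates (k : fieldType) (X : vectType k) (u v : X) :
  (forall f : {scalar X}, f u = f v) -> u = v.
Proof.
move=> h; rewrite (coord_vbasis (memvf u)) (coord_vbasis (memvf v)).
by apply: eq_bigr => i _; rewrite (h (coord (vbasis fullv) i)).
Qed.

Ltac vect_ring := apply: scalar_separates => ?;
  rewrite ?(linearD, linearN, linearZ, linear0) /=; ring.

Section Submodule.
Variables (k : fieldType) (X : vectType k).

(** Subspaces are predicates, so that one given by an existential statement can be used directly. *)
Definition submodule (Z : X -> Prop) :=
  Z 0 /\ forall a u v, Z u -> Z v -> Z (a *: u + v).

Variables (Z : X -> Prop) (hZ : submodule Z).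

Lemma submodule0 : Z 0. Proof. by case: hZ. Qed.
Lemma submoduleD u v : Z u -> Z v -> Z (u + v).
Proof. by case: hZ => _ h zu zv; rewrite -[u]scale1r; apply: h. Qed.
Lemma submoduleZ a u : Z u -> Z (a *: u).
Proof. by case: hZ => z0 h zu; rewrite -[_ *: _]addr0; apply: h. Qed.
Lemma submoduleN u : Z u -> Z (- u).
Proof. by rewrite -scaleN1r; apply: submoduleZ. Qed.
Lemma submoduleB u v : Z u -> Z v -> Z (u - v).
Proof. by move=> zu zv; apply: submoduleD => //; apply: submoduleN. Qed.
Lemma submodule_sum (I : Type) (r : seq I) (P : pred I) (F : I -> X) :
  (forall i, P i -> Z (F i)) -> Z (\sum_(i <- r | P i) F i).
Proof.
by move=> h; elim/big_ind: _ => //; [exact: submodule0 | exact: submoduleD].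
Qed.

End Submodule.

Section Symmetrizer.
Variables (k : fieldType) (m : nat) (q : k) (X : vectType k) (T : nat -> 'End(X)).
Hypotheses (hT : hecke_module m q T) (hq : forall r, (0 < r)%N -> qint q r != 0).
Variable D : pred nat.

(* [run_op n.+1 = 1 + T_n + T_n T_(n-1) + ...], the product stopping at the
   start of the maximal run of [D] ending in [n]. *)
Fixpoint run_op n : 'End(X) :=
  if n is n'.+1 then if D n' then (\1 + (T n' \o run_op n'))%VF else \1%VF else \1%VF.

(** The scalar by which [run_op n] acts on a common eigenvector: the q-integer of r+1, where r is
    the length of the run of [D] ending just before [n]. *)
Fixpoint run_coef n : k :=
  if n is n'.+1 then if D n' then 1 + q * run_coef n' else 1 else 1.

(** The sum of the T_w over the parabolic subgroup generated by the reflections in [D] below [n],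
    factored through minimal coset representatives. *)
Fixpoint sym_op n : 'End(X) :=
  if n is n'.+1 then (sym_op n' \o run_op n)%VF else \1%VF.

Fixpoint sym_coef n : k := if n is n'.+1 then sym_coef n' * run_coef n else 1.

Lemma run_op0 v : run_op 0 v = v. Proof. exact: id_lfunE. Qed.
Lemma sym_op0 v : sym_op 0 v = v. Proof. exact: id_lfunE. Qed.

Lemma run_opS n v : D n -> run_op n.+1 v = v + T n (run_op n v).
Proof. by move=> Dn; rewrite /= Dn add_lfunE comp_lfunE id_lfunE. Qed.

Lemma run_opSF n v : ~~ D n -> run_op n.+1 v = v.
Proof. by move=> /negbTE Dn; rewrite /= Dn id_lfunE. Qed.

Lemma sym_opS n v : sym_op n.+1 v = sym_op n (run_op n.+1 v).
Proof. by rewrite comp_lfunE. Qed.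

#[local] Arguments run_op : simpl never.
#[local] Arguments sym_op : simpl never.

Lemma run_op_comm n j v : (n < j)%N -> (j < m)%N -> T j (run_op n v) = run_op n (T j v).
Proof.
have [_ _ comm] := hT.
elim: n v => [|n IH] v nj jm; first by rewrite !id_lfunE.
have [Dn|Dn] := boolP (D n); last by rewrite !run_opSF.
by rewrite !run_opS // linearD -IH ?(comm n j) //; lia.
Qed.

Lemma sym_op_comm n j v : (n < j)%N -> (j < m)%N -> T j (sym_op n v) = sym_op n (T j v).
Proof.
elim: n v => [|n IH] v nj jm; first by rewrite !id_lfunE.
by rewrite !sym_opS IH ?run_op_comm //; lia.
Qed.

(** In the inductive step the product of two consecutive runs expands to three terms. The quadratic
    relation settles the first two; in the third the braid relation creates an inner [T n], which
    the induction hypothesis replaces by [q]. *)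
Lemma run_op_eigen n v : (n < m)%N -> D n ->
  T n (run_op n (run_op n.+1 v)) = q *: run_op n (run_op n.+1 v).
Proof.
have [quad braid comm] := hT.
elim: n v => [|n IH] v nm Dn.
  by rewrite run_opS // !run_op0 [T _ (_ + _)]linearD /= quad //; vect_ring.
have [D'|D'] := boolP (D n); last first.
  by rewrite (run_opS v Dn) !run_opSF // [T _ (_ + _)]linearD /= quad //; vect_ring.
set u := run_op n.+1 v.
have E : run_op n.+1 (run_op n.+2 v) = u + T n.+1 u + T n (T n.+1 (run_op n u)).
  rewrite (run_opS v Dn) -/u linearD /=.
  by rewrite [X in _ + X](run_opS _ D') -run_op_comm // -/u addrA.
have IHu : T n (run_op n u) = q *: run_op n u by apply: IH => //; lia.
rewrite E !linearD /= quad // -braid // IHu !linearZ /=; vect_ring.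
Qed.

(** Only the last generator is new. It commutes with the symmetrizer two stages earlier, and two
    consecutive runs remain. *)
Lemma sym_op_eigen n l v : (n <= m)%N -> (l < n)%N -> D l ->
  T l (sym_op n v) = q *: sym_op n v.
Proof.
elim: n l v => // n IH l v nm; rewrite ltnS leq_eqVlt => /orP[/eqP ->|ln] Dl; last first.
  by rewrite sym_opS IH //; lia.
case: n IH nm Dl => [|n] IH nm Dl.
  by rewrite sym_opS sym_op0; have := run_op_eigen v nm Dl; rewrite run_op0.
by rewrite !sym_opS sym_op_comm // run_op_eigen // linearZ.
Qed.

Lemma run_coef_neq0 n : run_coef n != 0.
Proof.
have [r ->] : exists r, run_coef n = qint q r.+1; last exact: hq.
elim: n => [|n [r IH]] /=; first by exists 0%N; rewrite /qint big_ord1.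
case: ifP => _; last by exists 0%N; rewrite /qint big_ord1.
exists r.+1; rewrite IH /qint [in RHS]big_ord_recl expr0; congr (_ + _).
by rewrite big_distrr; apply: eq_bigr => i _; rewrite lift0 exprS.
Qed.

Lemma sym_coef_neq0 n : sym_coef n != 0.
Proof. by elim: n => [|n IH]; rewrite ?oner_eq0 //= mulf_neq0 ?(run_coef_neq0 n.+1). Qed.

Section Mod.
Variable Z : X -> Prop.
Hypotheses (hZ : submodule Z) (ZT : forall l, (l < m)%N -> forall v, Z v -> Z (T l v)).
Variable v : X.
Hypothesis hv : forall l, (l < m)%N -> D l -> Z (T l v - q *: v).

Lemma run_op_stable n u : (n <= m)%N -> Z u -> Z (run_op n u).
Proof.
elim: n u => [|n IH] u nm zu; first by rewrite id_lfunE.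
have [Dn|Dn] := boolP (D n); last by rewrite run_opSF.
by rewrite run_opS //; apply: submoduleD => //; apply: ZT => //; apply: IH => //; lia.
Qed.

Lemma sym_op_stable n u : (n <= m)%N -> Z u -> Z (sym_op n u).
Proof.
elim: n u => [|n IH] u nm zu; first by rewrite id_lfunE.
by rewrite sym_opS; apply: IH; [lia | exact: run_op_stable].
Qed.

Lemma run_op_mod n : (n <= m)%N -> Z (run_op n v - run_coef n *: v).
Proof.
elim: n => [|n IH] nm.
  by rewrite id_lfunE scale1r subrr; exact: submodule0.
have [Dn|Dn] := boolP (D n); last first.
  by rewrite run_opSF //= (negbTE Dn) scale1r subrr; exact: submodule0.
rewrite run_opS //= Dn.
suff -> : v + T n (run_op n v) - (1 + q * run_coef n) *: v =
    T n (run_op n v - run_coef n *: v) + run_coef n *: (T n v - q *: v).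
  apply: submoduleD => //; first by apply: ZT => //; apply: IH; lia.
  by apply: submoduleZ => //; apply: hv.
by rewrite linearB linearZ /=; vect_ring.
Qed.

Lemma sym_op_mod n : (n <= m)%N -> Z (sym_op n v - sym_coef n *: v).
Proof.
elim: n => [|n IH] nm; first by rewrite id_lfunE scale1r subrr; exact: submodule0.
rewrite sym_opS.
suff -> : sym_op n (run_op n.+1 v) - sym_coef n.+1 *: v =
    sym_op n (run_op n.+1 v - run_coef n.+1 *: v) + run_coef n.+1 *: (sym_op n v - sym_coef n *: v).
  apply: submoduleD => //; first by apply: sym_op_stable; [lia | exact: run_op_mod].
  by apply: submoduleZ => //; apply: IH; lia.
have -> : sym_coef n.+1 = sym_coef n * run_coef n.+1 by [].
by rewrite linearB linearZ /= -/(run_coef n.+1); set c := run_coef n.+1; vect_ring.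
Qed.

(** Exactness of taking eigenspaces: if the class of [v] modulo [Z] is an eigenvector, the
    symmetrizer divided by its nonzero scalar produces an eigenvector in that class. *)
Lemma eigen_lift : exists2 u, eigen m q T D u & Z (u - v).
Proof.
exists ((sym_coef m)^-1 *: sym_op m v).
  by move=> l lm Dl; rewrite linearZ /= sym_op_eigen // !scalerA mulrC.
rewrite -[v in _ - v](scalerK (sym_coef_neq0 m)) -scalerBr.
by apply: submoduleZ => //; apply: sym_op_mod.
Qed.

End Mod.
End Symmetrizer.

(** * Coinduced modules and distributivity *)

Section Coinduced.
Variables (k : fieldType) (m : nat) (q : k) (X : vectType k).
Local Notation CX := {ffun {perm 'I_m.+1} -> X}.
Local Notation s := (sPerm m.+1).

(** The value [f w] behaves like T_w v, and the formula is the rule for the product of T_w and T_l.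
    This makes [w |-> perm_op T w v] a map of modules. *)
Definition coind_fun l (f : CX) : CX := [ffun w =>
  if ascent l w then f (s l * w)%g else q *: f (s l * w)%g + (q - 1) *: f w].

Fact coind_fun_linear l : linear (coind_fun l).
Proof.
move=> a f g; apply/ffunP => w; rewrite !ffunE; case: ifP => _ //.
by vect_ring.
Qed.
HB.instance Definition _ l := GRing.isLinear.Build k CX CX _ (coind_fun l) (coind_fun_linear l).

Definition coind_op l : 'End(CX) := linfun (coind_fun l).

Lemma coind_opE l f w : coind_op l f w =
  if ascent l w then f (s l * w)%g else q *: f (s l * w)%g + (q - 1) *: f w.
Proof. by rewrite lfunE /= ffunE. Qed.

Lemma coind_hecke : hecke_module m q coind_op.
Proof.
split.
- move=> l lm f; apply/ffunP => w.
  rewrite coind_opE [RHS]ffunE !ffunE !coind_opE ascent_sPerm // sPerm_mulK.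
  by case: (ascent l w); rewrite ?[~~ _]/=; vect_ring.
- move=> l lm f; apply/ffunP => w; have lm' := ltnW lm.
  have E : (s l.+1 * (s l * (s l.+1 * w)) = s l * (s l.+1 * (s l * w)))%g.
    by rewrite !mulgA sPerm_braid.
  rewrite !coind_opE !ascent_sPerm // !sPerm_mulK E.
  have e1 : s l (inord l.+2) = inord l.+2 by apply: sPerm_far; lia.
  have e2 : s l.+1 (inord l) = inord l by apply: sPerm_far; lia.
  have inj i j : (i <= m)%N -> (j <= m)%N -> i != j -> w (inord i) != w (inord j) :> nat.
    by move=> im jm; rewrite (inj_eq val_inj) (inj_eq perm_inj) -val_eqE /= !inordK.
  have xy := inj l l.+1 ltac:(lia) ltac:(lia) ltac:(lia).
  have yz := inj l.+1 l.+2 ltac:(lia) ltac:(lia) ltac:(lia).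
  have xz := inj l l.+2 ltac:(lia) ltac:(lia) ltac:(lia).
  (* Both sides depend only on the relative order of the entries of [w] at three consecutive
     positions, which leaves six linear identities. *)
  rewrite /ascent !permM !(sPermL, sPermR, e1, e2).
  move: (f _) (f (s l * w)%g) (f (s l.+1 * w)%g) (f (s l * (s l.+1 * w))%g)
    (f (s l.+1 * (s l * w))%g) (f w) => f1 f2 f3 f4 f5 f6.
  case: (ltngtP (w (inord l)) (w (inord l.+1))) xy => //= xy _;
  case: (ltngtP (w (inord l.+1)) (w (inord l.+2))) yz => //= yz _;
  case: (ltngtP (w (inord l)) (w (inord l.+2))) xz => //= xz _; try lia; vect_ring.
- move=> i j ij jm f; apply/ffunP => w; have im : (i < m)%N by lia.
  rewrite !coind_opE !ascent_far ?ij ?orbT // !mulgA (sPerm_comm ij jm).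
  by case: ifP => _; case: ifP => _ //; vect_ring.
Qed.

End Coinduced.

(** * The Bruhat order through rank functions *)

Section Bruhat.
Variable m : nat.
Implicit Types (u w : {perm 'I_m.+1}).
Local Notation s := (sPerm m.+1).

(** The rank matrix of [w]; its entrywise comparison is the rank criterion for the Bruhat order. *)
Definition brank w i j : nat := \sum_(0 <= a < i) (j <= w (inord a))%N.
Definition bruhat u w := [forall i : 'I_m.+2, forall j : 'I_m.+1, brank u i j <= brank w i j]%N.
(** A number that increases strictly along the Bruhat order and serves as induction measure. *)
Definition height w : nat := \sum_(i < m.+2) \sum_(j < m.+1) brank w i j.

Lemma brankS w i j : brank w i.+1 j = (brank w i j + (j <= w (inord i)))%N.
Proof. by rewrite /brank big_nat_recr. Qed.

Lemma brank_sPerm w l i j : (l < m)%N -> (i <= m.+1)%N -> i != l.+1 ->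
  brank (s l * w)%g i j = brank w i j.
Proof.
move=> lm im; have low i' : (i' <= l)%N -> brank (s l * w)%g i' j = brank w i' j.
  move=> il; apply: eq_big_nat => a /andP[_ ai]; rewrite permM sPerm_far //; lia.
have [il _|] := leqP i l; first exact: low.
rewrite leq_eqVlt eq_sym => /orP[->//|] li _.
elim: i im li => // i IH im; rewrite ltnS leq_eqVlt => /orP[/eqP <-|li].
  by rewrite !brankS low // !permM sPermL sPermR addnAC.
by rewrite !brankS IH //; [rewrite permM sPerm_far //; lia | lia].
Qed.

Lemma brank_sPermS w l j : (l < m)%N ->
  brank (s l * w)%g l.+1 j = (brank w l j + (j <= w (inord l.+1)))%N.
Proof. by move=> lm; rewrite brankS brank_sPerm ?permM ?sPermL //; lia. Qed.

Lemma bruhatP u w : reflect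
  (forall i j, (i <= m.+1)%N -> (j <= m)%N -> (brank u i j <= brank w i j)%N) (bruhat u w).
Proof.
apply: (iffP 'forall_forallP) => [h i j im jm|h i j]; last by apply: h; rewrite -ltnS.
by have := h (Ordinal (im : (i < m.+2)%N)) (Ordinal (jm : (j < m.+1)%N)).
Qed.

Lemma bruhat_refl w : bruhat w w.
Proof. by apply/bruhatP. Qed.

Lemma bruhat_height u w : bruhat u w -> (height u <= height w)%N.
Proof. by move/'forall_forallP => h; apply: leq_sum => i _; apply: leq_sum => j _. Qed.

(** Comparable ranks with equal sums are all equal, and their differences in [i] tell which [j] are
    at most each entry, hence the entry itself. *)
Lemma bruhat_eq u w : bruhat u w -> (height w <= height u)%N -> u = w.
Proof.
move=> /'forall_forallP h le.
have E (i : 'I_m.+2) (j : 'I_m.+1) : brank u i j = brank w i j.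
  have := leqif_sum (fun (i : 'I_m.+2) (_ : true) =>
    leqif_sum (fun (j : 'I_m.+1) (_ : true) => leqif_eq (h i j))).
  move=> [_]; rewrite -/(height u) -/(height w) eqn_leq le andbT.
  have -> : (height u <= height w)%N by apply: bruhat_height; apply/'forall_forallP.
  by move/esym/forall_inP/(_ i isT)/forall_inP/(_ j isT)/eqP.
have E' (a j : 'I_m.+1) : (j <= u a)%N = (j <= w a)%N.
  have e := E (widen_ord (leqnSn _) a) j; have := E (lift ord0 a) j.
  rewrite /= in e; rewrite lift0 !brankS inord_val e.
  by move/addnI; case: (j <= u a)%N; case: (j <= w a)%N.
apply/permP => a; apply: val_inj => /=.
by have := E' a (u a); have := E' a (w a); rewrite !leqnn => ? ?; lia.
Qed.

Lemma bruhat_ascent l w : (l < m)%N -> ascent l w -> bruhat w (s l * w)%g.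
Proof.
move=> lm up; apply/bruhatP => i j im jm.
have [->|il] := eqVneq i l.+1; last by rewrite brank_sPerm.
by rewrite brank_sPermS // brankS leq_add2l; move: up; rewrite /ascent; lia.
Qed.

Lemma height_ascent l w : (l < m)%N -> ascent l w -> (height w < height (s l * w)%g)%N.
Proof.
move=> lm up; rewrite ltnNge; apply/negP => /(bruhat_eq (bruhat_ascent lm up)) E.
by have := ascent_sPerm w lm; rewrite -E; case: (ascent l w).
Qed.

(** The lifting property. Only row [l.+1] of the rank matrix of [u] changes. There the bound comes
    from rows [l] and [l.+2], because at a descent [w] has the larger of the two entries first. *)
Lemma bruhat_descent l u w : (l < m)%N -> ~~ ascent l w -> bruhat u w ->
  bruhat (s l * u)%g w.
Proof.
move=> lm dn /bruhatP h; apply/bruhatP => i j im jm.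
have [->|il] := eqVneq i l.+1; last by rewrite brank_sPerm //; apply: h.
have h1 := h l j ltac:(lia) jm; have := h l.+2 j ltac:(lia) jm.
rewrite brank_sPermS // !brankS; move: dn; rewrite /ascent.
by do 4![case: (leqP j _) => ? /=]; lia.
Qed.

Lemma bruhat_sPerm l u w : (l < m)%N -> ~~ ascent l w ->
  bruhat (s l * u)%g w = bruhat u w.
Proof.
move=> lm dn; apply/idP/idP; last exact: bruhat_descent.
by move=> h; rewrite -(sPerm_mulK l u); apply: bruhat_descent.
Qed.

End Bruhat.

(** * Distributivity in the coinduced module *)

Section Free.
Variables (k : fieldType) (m : nat) (q : k) (X : vectType k) (Z : X -> Prop).
Hypotheses (q0 : q != 0) (hZ : submodule Z).
Local Notation CX := {ffun {perm 'I_m.+1} -> X}.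
Local Notation s := (sPerm m.+1).
Local Notation T := (@coind_op k m q X).

(** The eigenvalue equation at an ascent is the stated one, and it implies the equation at the
    corresponding descent. *)
Lemma eigen_coind (D : pred nat) (f : CX) : eigen m q T D f <->
  forall l w, (l < m)%N -> D l -> ascent l w -> f (s l * w)%g = q *: f w.
Proof.
split=> [h l w lm Dl up|h l lm Dl].
  by have /ffunP/(_ w) := h l lm Dl; rewrite coind_opE up ffunE.
apply/ffunP => w; rewrite coind_opE ffunE; case: ifP => [|/negbT dn]; first exact: h.
rewrite -{2 3}(sPerm_mulK l w) [f (s l * (s l * w))%g]h ?ascent_sPerm //.
by vect_ring.
Qed.

(** The indicator of the Bruhat interval [1, w], rescaled by q^length. It is an eigenvector for
    every descent [l] of [w], since the interval is then stable under [s l]. *)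
Definition bruhat_fun (w u : {perm 'I_m.+1}) : k :=
  if bruhat u w then q ^+ perm_len u else 0.

Lemma bruhat_fun_eigen (P : pred {perm 'I_m.+1}) (c : {perm 'I_m.+1} -> X) (D : pred nat) :
  (forall w l, P w -> c w != 0 -> (l < m)%N -> D l -> ~~ ascent l w) ->
  eigen m q T D [ffun u => \sum_(w | P w) bruhat_fun w u *: c w].
Proof.
move=> h; apply/eigen_coind => l u lm Dl up; rewrite !ffunE scaler_sumr.
apply: eq_bigr => w Pw; have [->|cw] := eqVneq (c w) 0; first by rewrite !scaler0.
rewrite scalerA /bruhat_fun bruhat_sPerm //; last exact: (h w).
by case: ifP => _; rewrite ?mulr0 // perm_len_ascent // exprS.
Qed.

(** Induction on a bound for the heights where the [x j] are nonzero. The values at the top height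
    are removed by subtracting multiples of Bruhat functions that lie in the same eigenspaces. *)
Lemma free_dist r (D : nat -> pred nat) (x : nat -> CX) :
  (forall j, (j <= r)%N -> eigen m q T (D j) (x j)) ->
  (forall w, Z (\sum_(j < r.+1) x j w)) ->
  exists2 u : nat -> CX, forall j, (j < r)%N -> eigen m q T (predU (D 0%N) (D j.+1)) (u j) &
    forall w, Z (x 0%N w - \sum_(j < r) u j w).
Proof.
move: x.
suff main h (x : nat -> CX) : (forall j w, (j <= r)%N -> (h <= height w)%N -> x j w = 0) ->
    (forall j, (j <= r)%N -> eigen m q T (D j) (x j)) ->
    (forall w, Z (\sum_(j < r.+1) x j w)) ->
    exists2 u : nat -> CX, forall j, (j < r)%N -> eigen m q T (predU (D 0%N) (D j.+1)) (u j) &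
      forall w, Z (x 0%N w - \sum_(j < r) u j w).
  move=> x; apply: (main (\max_(w : {perm 'I_m.+1}) height w).+1) => j w _ hw.
  by move: hw; rewrite ltnNge (leq_bigmax (F := @height m) w).
elim: h x => [|h IH] x van ex zx.
  exists (fun=> 0) => [j _ l _ _|w]; first by rewrite linear0 scaler0.
  rewrite van // sub0r big1 ?oppr0 => [|j _]; last by rewrite ffunE.
  exact: submodule0.
(* An ascent in [D j] would force a nonzero value at [s l * w], which is strictly higher. *)
have desc j w l : (j <= r)%N -> height w == h -> x j w != 0 -> (l < m)%N -> D j l -> ~~ ascent l w.
  move=> jr /eqP hw xw lm Dl; apply/negP => up.
  have /eigen_coind/(_ l w lm Dl up) := ex j jr.
  rewrite van //; last by rewrite -hw height_ascent.
  by move/esym/eqP; rewrite scaler_eq0 (negbTE q0) (negbTE xw).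
pose c j w := (q ^- perm_len w) *: x j w.
have c0 j w : (c j w != 0) = (x j w != 0).
  by rewrite /c scaler_eq0 invr_eq0 expf_eq0 (negbTE q0) andbF.
pose top (P : pred {perm 'I_m.+1}) j : CX :=
  [ffun u => \sum_(w | (height w == h) && P w) bruhat_fun w u *: c j w].
pose y j := x j - top predT j.
have [|||u eu zu] := IH y.
- move=> j u jr; rewrite leq_eqVlt => /orP[/eqP hu|hu]; rewrite !ffunE.
    rewrite (bigD1 u) /= -?hu ?eqxx // big1 ?addr0.
      by rewrite /bruhat_fun bruhat_refl /c scalerA divff ?scale1r ?subrr ?expf_neq0.
    move=> w /andP[/andP[/eqP hw _] wu]; rewrite /bruhat_fun ifN ?scale0r //.
    by apply: contra wu => le; rewrite (bruhat_eq le) // hw hu.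
  rewrite van // big1 ?subr0 // => w /andP[/eqP hw _].
  rewrite /bruhat_fun ifN ?scale0r //; apply/negP => /bruhat_height; lia.
- move=> j jr l lm Dl; rewrite linearB /= (ex j jr l lm Dl) scalerBr; congr (_ - _).
  apply: (@bruhat_fun_eigen _ _ (D j)) => // w l' /andP[hw _]; rewrite c0 => xw.
  exact: desc.
- move=> u; rewrite (eq_bigr (fun j : 'I_r.+1 => x j u - top predT j u)); last by move=> j _; rewrite !ffunE.
  rewrite sumrB; apply: submoduleB => //.
  rewrite (eq_bigr (fun j : 'I_r.+1 => \sum_(w | (height w == h) && true) bruhat_fun w u *: c j w)); last first.
    by move=> j _; rewrite ffunE.
  rewrite exchange_big; apply: submodule_sum => // w _.
  by rewrite -scaler_sumr -scaler_sumr; do 2!apply: (submoduleZ hZ).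
(* The top terms are redistributed only where [x 0] is nonzero, so that the descents of [w] contain
   [D 0] as well as [D j.+1]. There the relation modulo [Z] expresses the top term of [x 0] by the
   others. *)
pose P w := x 0%N w != 0.
exists (fun j => u j - top P j.+1).
  move=> j jr l lm Dl; rewrite linearB /= (eu j jr l lm Dl) scalerBr; congr (_ - _).
  apply: (@bruhat_fun_eigen _ _ (predU (D 0%N) (D j.+1))) => // w l' /andP[hw Pw]; rewrite c0 => xw l'm.
  by move=> /orP[]; [exact: (desc 0%N) | exact: (desc j.+1)].
move=> w.
suff -> : x 0%N w - \sum_(j < r) (u j - top P j.+1) w =
   (y 0%N w - \sum_(j < r) u j w) +
     \sum_(v | (height v == h) && P v) bruhat_fun v w *: (q ^- perm_len v *: \sum_(j < r.+1) x j v).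
  apply: submoduleD => //; apply: submodule_sum => // v _.
  by do 2!apply: (submoduleZ hZ).
have -> : y 0%N w = x 0%N w - top P 0%N w.
  rewrite !ffunE; congr (_ - _).
  rewrite [RHS]big_mkcondr; apply: eq_big => [v|v _]; first by rewrite andbT.
  by rewrite /P -c0; case: eqP => [->|//]; rewrite scaler0.
have -> : \sum_(j < r) (u j - top P j.+1) w = \sum_(j < r) u j w - \sum_(j < r) top P j.+1 w.
  by rewrite -sumrB; apply: eq_bigr => j _; rewrite !ffunE.
have -> : \sum_(v | (height v == h) && P v) bruhat_fun v w *: (q ^- perm_len v *: \sum_(j < r.+1) x j v)
    = \sum_(j < r.+1) top P j w.
  rewrite [RHS](eq_bigr (fun j : 'I_r.+1 => \sum_(v | (height v == h) && P v) bruhat_fun v w *: c j v)); last first.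
    by move=> j _; rewrite ffunE.
  by rewrite exchange_big; apply: eq_bigr => v _; rewrite -!scaler_sumr.
rewrite big_ord_recl /=.
by move: (x _ _) (top _ _ _) (\sum_(_ < _) _) (\sum_(_ < _) _) => a b e f; vect_ring.
Qed.

End Free.

(** * Distributivity in arbitrary Hecke modules *)

Section Distributive.
Variables (k : fieldType) (m : nat) (q : k).
Hypotheses (q0 : q != 0) (hq : forall r, (0 < r)%N -> qint q r != 0).

Section Pair.
Variables (X : vectType k) (T : nat -> 'End(X)) (Z : X -> Prop).

Definition stable_submodule :=
  submodule Z /\ forall l, (l < m)%N -> forall v, Z v -> Z (T l v).

(* Distributivity of the eigenspaces of [X / Z], each class being represented
   by an eigenvector in [X]. *)
Definition dist r := forall (D : nat -> pred nat) (x : nat -> X),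
  (forall j, (j <= r)%N -> eigen m q T (D j) (x j)) -> Z (\sum_(j < r.+1) x j) ->
  exists2 u : nat -> X, forall j, (j < r)%N -> eigen m q T (predU (D 0%N) (D j.+1)) (u j) &
    Z (x 0%N - \sum_(j < r) u j).

Lemma eigenD D u v : eigen m q T D u -> eigen m q T D v -> eigen m q T D (u + v).
Proof. by move=> eu ev l lm Dl; rewrite linearD /= eu // ev // scalerDr. Qed.
Lemma eigenN D u : eigen m q T D u -> eigen m q T D (- u).
Proof. by move=> eu l lm Dl; rewrite linearN /= eu // scalerN. Qed.
Lemma eigen0 D : eigen m q T D 0.
Proof. by move=> l lm Dl; rewrite linear0 scaler0. Qed.
Lemma eigen_sum D (I : Type) (r : seq I) (P : pred I) (F : I -> X) :
  (forall i, P i -> eigen m q T D (F i)) -> eigen m q T D (\sum_(i <- r | P i) F i).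
Proof. by move=> h; elim/big_ind: _ => //; [exact: eigen0 | exact: eigenD]. Qed.
Lemma eigen_sub (D D' : pred nat) u : subpred D D' -> eigen m q T D' u -> eigen m q T D u.
Proof. by move=> sub eu l lm /sub; exact: eu. Qed.

(** Eigenvectors with sum zero modulo [Z] can be changed within their classes to have sum zero.
    Distributivity replaces [x 0] by the sum of the [u j], these are absorbed into the other terms,
    and the shorter family is lifted by induction. *)
Lemma dist_lift r : submodule Z -> (forall r', (r' < r)%N -> dist r') ->
  forall (D : nat -> pred nat) (x : nat -> X),
  (forall j, (j < r)%N -> eigen m q T (D j) (x j)) -> Z (\sum_(j < r) x j) ->
  exists y : nat -> X, [/\ forall j, (j < r)%N -> eigen m q T (D j) (y j),
    \sum_(j < r) y j = 0 & forall j, (j < r)%N -> Z (x j - y j)].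
Proof.
move=> hZ; elim: r => [|r IH] hd D x ex zx.
  by exists x; rewrite big_ord0; split.
have [u eu zu] := hd r (ltnSn r) D x ex zx.
have [|j jr||y [ey sy zy]] :=
  IH _ (fun j => D j.+1) (fun j => x j.+1 + u j); first by move=> r' /leqW; exact: hd.
- apply: eigenD; first exact: ex.
  by apply: eigen_sub (eu j jr) => l /= ->; rewrite orbT.
- rewrite big_split /=; move: (submoduleB hZ zx zu); rewrite big_ord_recl /=.
  suff -> : forall a b c : X, a + b - (a - c) = b + c by [].
  by move=> a b c; vect_ring.
exists (fun j => if j is j'.+1 then y j' - u j' else \sum_(i < r) u i); split.
- case=> [_|j jr]; first apply: eigen_sum => i _.
    by apply: eigen_sub (eu i (ltn_ord i)) => l /= ->.
  apply: eigenD; first exact: ey.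
  by apply: eigenN; apply: eigen_sub (eu j jr) => l /= ->; rewrite orbT.
- by rewrite big_ord_recl /= sumrB sy sub0r subrr.
by case=> [_|j jr] //; rewrite opprB addrA; apply: zy.
Qed.

End Pair.

(** The module and the submodule vary in the induction, because the cases of smaller [r] are applied
    to the coinduced module of [X] modulo the submodule [Z'] below. *)
Theorem eigen_dist r : forall (X : vectType k) (T : nat -> 'End(X)) (Z : X -> Prop),
  hecke_module m q T -> stable_submodule T Z -> dist T Z r.
Proof.
elim/ltn_ind: r => r IH X T Z hT [hZ ZT] D x ex zx.
pose emb (v : X) : {ffun {perm 'I_m.+1} -> X} := [ffun w => perm_op T w v].
pose cT := @coind_op k m q X.
have embT l v : (l < m)%N -> cT l (emb v) = emb (T l v).
  move=> lm; apply/ffunP => w; rewrite coind_opE !ffunE.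
  case: ifP => [up|/negbT dn]; first by rewrite (perm_op_ascent hT).
  by rewrite (perm_op_descent hT _ lm dn) addrC.
have stab (w : {perm 'I_m.+1}) v : Z v -> Z (perm_op T w v).
  rewrite /perm_op; case/andP: (xchooseP (reduced_word_subproof w)) => /andP[+ _] _.
  elim: (xchoose _) => [|l t IHt] /=; first by rewrite id_lfunE.
  by move=> /andP[lm ir] zv; rewrite comp_lfunE; apply: ZT => //; exact: IHt.
(* The image of [X] plus the functions with values in [Z]: dividing by [Z'] gives the cokernel of
   the embedding of X/Z into its coinduced module. *)
pose Z' (f : {ffun {perm 'I_m.+1} -> X}) := exists v, forall w, Z (f w - emb v w).
have hZ' : submodule Z'.
  split=> [|a f g [v zv] [v' zv']].
    exists 0 => w; rewrite !ffunE linear0 subrr; exact: submodule0.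
  exists (a *: v + v') => w.
  suff -> : (a *: f + g) w - emb (a *: v + v') w = a *: (f w - emb v w) + (g w - emb v' w).
    by case: hZ => _; apply.
  by rewrite !ffunE linearP /=; vect_ring.
have Z'T l : (l < m)%N -> forall f, Z' f -> Z' (cT l f).
  move=> lm f [v zv]; exists (T l v) => w.
  rewrite -embT // !coind_opE; case: ifP => _; first exact: zv.
  suff -> : forall a b c d : X, q *: a + (q - 1) *: b - (q *: c + (q - 1) *: d) =
     q *: (a - c) + (q - 1) *: (b - d).
    by apply: submoduleD => //; apply: submoduleZ.
  by move=> a b c d; vect_ring.
have eemb D' v : eigen m q T D' v -> eigen m q cT D' (emb v).
  move=> ev l lm Dl; rewrite embT // ev //.
  by apply/ffunP => w; rewrite !ffunE linearZ.
have [||z ez zz] := @free_dist k m q X Z q0 hZ r D (fun j => emb (x j)).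
- by move=> j jr; apply: eemb; exact: ex.
- move=> w; rewrite (eq_bigr (fun j : 'I_r.+1 => perm_op T w (x j))); last by move=> j _; rewrite ffunE.
  by rewrite -linear_sum; apply: stab.
(* Modulo functions into [Z] the [z j] add up to [emb (x 0)], so they sum to zero in the cokernel.
   Subtracting the lifted relation [y] makes every [z j - y j] come from [X]. *)
have [|||y [ey sy zy]] := @dist_lift _ cT Z' r hZ' _ (fun j => predU (D 0%N) (D j.+1)) z => //.
- by move=> r' r'r; apply: IH => //; exact: coind_hecke.
- exists (x 0%N) => w; rewrite sum_ffunE -opprB.
  by apply: submoduleN.
have /fin_all_exists[v hv] (j : 'I_r) : exists v, [/\ eigen m q T (predU (D 0%N) (D j.+1)) v &
    Z (v - (z j 1%g - y j 1%g))].
  have [v zv] := zy j (ltn_ord j).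
  have v1 : Z (v - (z j 1%g - y j 1%g)).
    have := zv 1%g; rewrite !ffunE (perm_op1 hT).
    by move/(submoduleN hZ); rewrite opprB.
  have ezy : eigen m q cT (predU (D 0%N) (D j.+1)) (z j - y j).
    by apply: eigenD; [exact: ez | apply: eigenN; exact: ey].
  (* Comparing the values at 1 and at [s l] shows that [v] is an eigenvector modulo [Z]. *)
  have [l lm Dl|u eu zu] := @eigen_lift k m q X T hT hq (predU (D 0%N) (D j.+1)) Z hZ ZT v.
    have up : ascent l (1%g : {perm 'I_m.+1}) by rewrite /ascent !perm1 !inordK //; lia.
    have /eigen_coind/(_ l 1%g lm Dl up) E := ezy.
    have h1 := zv 1%g; have h2 := zv (sPerm m.+1 l * 1)%g.
    have : Z (q *: ((z j - y j) 1%g - emb v 1%g) -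
       ((z j - y j) (sPerm m.+1 l * 1)%g - emb v (sPerm m.+1 l * 1)%g)).
      by apply: submoduleB => //; apply: submoduleZ.
    rewrite E !ffunE -(perm_op_ascent hT) // !(perm_op1 hT).
    suff -> : forall a b c : X, q *: (a - b) - (q *: a - c) = c - q *: b by [].
    by move=> a b c; vect_ring.
  exists u; split=> //.
  by rewrite -[u](subrK v) -addrA; apply: submoduleD.
exists (fun j => if insub j is Some i then v i else 0).
  by move=> j jr; rewrite insubT /=; case: (hv (Ordinal jr)).
rewrite (eq_bigr (fun j : 'I_r => v j)); last by move=> j _; rewrite valK.
have z1 := zz 1%g; rewrite ffunE (perm_op1 hT) in z1.
suff -> : x 0%N - \sum_(j < r) v j = (x 0%N - \sum_(j < r) z j 1%g) -
    \sum_(j < r) (v j - (z j 1%g - y j 1%g)) + (\sum_(j < r) y j) 1%g.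
  rewrite sy ffunE addr0; apply: submoduleB => //; apply: submodule_sum => // j _.
  by case: (hv j).
rewrite sum_ffunE !sumrB.
by move: (\sum_(_ < _) _) (\sum_(_ < _) _) (\sum_(_ < _) _) => a b c; vect_ring.
Qed.

End Distributive.

(** * The image of the q-symmetrizer *)

Lemma lift_perm_maxP n (s : {perm 'I_n.+1}) : s ord_max = ord_max ->
  exists r : {perm 'I_n}, s = lift_perm ord_max ord_max r.
Proof.
move=> sm.
have ex (i : 'I_n) : exists j : 'I_n, lift ord_max j = s (lift ord_max i).
  have : ord_max != s (lift ord_max i).
    by rewrite -[X in X != _]sm (inj_eq perm_inj) neq_lift.
  by case/unlift_some => j -> _; exists j.
have [f fE] := fin_all_exists ex.
have f_inj : injective f.
  by move=> i j fij; apply: (@lift_inj _ ord_max); apply: (@perm_inj _ s); rewrite -!fE fij.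
exists (perm f_inj); apply/permP => i.
by case: (unliftP ord_max i) => [j|] ->; rewrite ?lift_perm_id ?lift_perm_lift ?permE ?fE.
Qed.

Lemma perm_len_lift_max n (s : {perm 'I_n}) :
  perm_len (lift_perm ord_max ord_max s) = perm_len s.
Proof.
pose h (p : 'I_n * 'I_n) := (lift ord_max p.1, lift ord_max p.2) : 'I_n.+1 * 'I_n.+1.
have h_inj : injective h 
  by move=> [a b] [c d] /eqP; rewrite xpair_eqE !(inj_eq (@lift_inj _ _)) => /andP[/eqP /= -> /eqP ->].
rewrite /perm_len -(card_imset _ h_inj); apply: eq_card => -[a b].
apply/idP/imsetP; rewrite !inE /=.
  case: (unliftP ord_max a) => [i|] ->; last by have := leq_ord b; rewrite /= ltnNge => ->.
  case: (unliftP ord_max b) => [j|] ->; last first.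
    rewrite lift_perm_id => /andP[_].
    by have := leq_ord (lift_perm ord_max ord_max s (lift ord_max i)); rewrite /= leqNgt => /negbTE ->.
  rewrite !lift_perm_lift !lift_max => ij; exists (i, j) => //.
  by rewrite inE.
by case=> -[i j]; rewrite inE /= => ij [-> ->]; rewrite !lift_perm_lift !lift_max.
Qed.

Section Poincare.
Variables (k : fieldType) (q : k).

(** Permutations are sorted by the position of their largest value. Moving it one place to the left
    multiplies the weight by [q]; when it stands last, a permutation of fewer letters remains. *)
Lemma sum_perm_len n : \sum_(s : {perm 'I_n}) q ^+ perm_len s = qfact q n.
Proof.
elim: n => [|n IH].
  rewrite /qfact big_ord0 (big_pred1 1%g) => [|s].
    by rewrite (_ : perm_len _ = 0%N) //; apply/eqP; rewrite cards_eq0; apply/eqP/setP=> -[[]].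
  by apply/esym/eqP/permP => -[].
pose F j := \sum_(s : {perm 'I_n.+1} | s (inord j) == ord_max) q ^+ perm_len s.
have FS j : (j < n)%N -> F j = q * F j.+1.
  move=> jn; rewrite /F (reindex_inj (mulgI (sPerm n.+1 j))) /= big_distrr /=.
  apply: eq_big => [s|s]; rewrite permM sPermL // => /eqP smax.
  rewrite perm_len_ascent // ?exprS // /ascent smax ltn_neqAle leq_ord andbT /=.
  by rewrite -[X in _ != X]/(val (@ord_max n)) (inj_eq val_inj) -smax (inj_eq perm_inj) inord_neq.
have Fn : F n = qfact q n.
  have L_inj : injective (fun s : {perm 'I_n} => lift_perm ord_max ord_max s).
    move=> s s' E; apply/permP => i; apply: (@lift_inj _ ord_max).
    by rewrite -!(lift_perm_lift ord_max ord_max) E.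
  rewrite -IH; under eq_bigr do rewrite -perm_len_lift_max.
  rewrite -(big_imset (fun s => q ^+ perm_len s) (in2W L_inj)).
  apply: eq_bigl => s; have -> : inord n = ord_max :> 'I_n.+1 by apply: val_inj; rewrite /= inordK.
  by apply/eqP/imsetP => [/lift_perm_maxP[r ->]|[r _ ->]]; [exists r | rewrite lift_perm_id].
have Fsub j : (j <= n)%N -> F (n - j)%N = q ^+ j * F n.
  elim: j => [|j IHj] jn; first by rewrite subn0 mul1r.
  rewrite FS; last by lia.
  by rewrite -subSn // subSS IHj ?exprS ?mulrA // ltnW.
rewrite (partition_big (fun s : {perm 'I_n.+1} => s^-1%g ord_max) predT) //=.
rewrite (reindex_inj rev_ord_inj) /= (_ : qfact q n.+1 = F n * qint q n.+1); last by rewrite Fn /qfact big_ord_recr.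
rewrite /qint big_distrr /=.
apply: eq_bigr => j _; rewrite [RHS]mulrC -Fsub ?leq_ord //.
apply: eq_bigl => s; rewrite (can2_eq (permKV s) (permK s)) eq_sym; congr (s _ == _).
have nj : (n - j < n.+1)%N by rewrite ltnS leq_subr.
by apply: ord_inj; rewrite inordK //= subSS.
Qed.

End Poincare.

(** * The symmetrizer as a projection onto the common eigenspace *)

Section RhoX.
Variables (k : fieldType) (m n : nat) (q : k) (R : 'End(TV k n 2)).
Hypotheses (hq : forall r, (0 < r)%N -> qint q r != 0).
Local Notation X := (TV k n m.+1).
Local Notation T := (@rhoT k n m.+1 R).
Hypothesis hT : hecke_module m q T.

(** A word of length [perm_len s] spelling [s] always exists, so the default branch never occurs,
    and all such words give the same operator. *)
Lemma rhoTsigmaE s : rhoTsigma R s =1 perm_op T s.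
Proof.
rewrite /rhoTsigma; case: pickP => [t /eqP tE|none] v.
  apply: (perm_op_word hT) => //; rewrite /reduced tE size_map size_tuple eqxx andbT.
  by apply/allP => i /mapP[j _ ->]; exact: ltn_ord j.
have [t /andP[ir /eqP st] tE] := reduced_exists s.
have szt : size (pmap insub t : seq 'I_m) == perm_len s.
  by rewrite size_pmap_sub -tE -st -all_count.
have := none (Tuple szt) => /=; rewrite (_ : map _ _ = t) ?tE ?eqxx //.
by rewrite (pmap_filter (insubK _)); apply/all_filterP/allP => i /(allP ir) im; rewrite insubT.
Qed.

Let P v := \sum_(s : {perm 'I_m.+1}) perm_op T s v.

Lemma rhoXE v : rhoX m.+1 q R v = (qfact q m.+1)^-1 *: P v.
Proof. by rewrite scale_lfunE sum_lfunE; congr (_ *: _); apply: eq_bigr => s _; exact: rhoTsigmaE. Qed.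

Lemma sum_perm_op_gen l v : (l < m)%N -> P (T l v) = q *: P v.
Proof.
move=> lm; rewrite /P (bigID (ascent l)) /=.
rewrite (eq_bigr _ (fun s up => perm_op_ascent hT v lm up)).
rewrite [X in _ + X](eq_bigr _ (fun s dn => perm_op_descent hT v lm dn)).
rewrite big_split /= -!scaler_sumr.
have up : \sum_(s : {perm 'I_m.+1} | ascent l s) perm_op T (sPerm m.+1 l * s)%g v =
    \sum_(s : {perm 'I_m.+1} | ~~ ascent l s) perm_op T s v.
  by rewrite [RHS](reindex_inj (mulgI (sPerm m.+1 l))); apply: eq_bigl => s; rewrite ascent_sPerm // negbK.
have dn : \sum_(s : {perm 'I_m.+1} | ~~ ascent l s) perm_op T (sPerm m.+1 l * s)%g v =
    \sum_(s : {perm 'I_m.+1} | ascent l s) perm_op T s v.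
  by rewrite [RHS](reindex_inj (mulgI (sPerm m.+1 l))); apply: eq_bigl => s; rewrite ascent_sPerm.
rewrite up dn [in RHS](bigID (ascent l)) /=.
by move: (\sum_(_ | ascent l _) _) (\sum_(_ | ~~ ascent l _) _) => a b; vect_ring.
Qed.

Lemma word_op_eigen t v : eigen m q T predT v -> inrange m t ->
  word_op T t v = q ^+ size t *: v.
Proof.
move=> ev; elim: t => [|l t IH] /=; first by rewrite id_lfunE scale1r.
by move=> /andP[lm ir]; rewrite comp_lfunE IH // linearZ /= ev // scalerA exprSr.
Qed.

Lemma sum_perm_op_eigen v : eigen m q T predT v -> P v = qfact q m.+1 *: v.
Proof.
move=> ev; rewrite -sum_perm_len scaler_suml; apply: eq_bigr => s _.
have [t rt tE] := reduced_exists s.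
rewrite -(perm_op_word hT rt tE) word_op_eigen //; last by case/andP: rt.
by case/andP: rt => _ /eqP ->; rewrite tE.
Qed.

Lemma qfact_neq0 r : qfact q r != 0.
Proof. by apply/prodf_neq0 => i _; apply: hq. Qed.

Lemma rhoX_eigen v : eigen m q T predT v -> rhoX m.+1 q R v = v.
Proof. by move=> ev; rewrite rhoXE sum_perm_op_eigen // scalerK // qfact_neq0. Qed.

(** Modulo the kernel of [P] every vector is an eigenvector. Lifting gives an eigenvector [u] with
    [P u = P v], and [rhoX] then sends [v] to [u]. *)
Lemma eigen_rhoX v : eigen m q T predT (rhoX m.+1 q R v).
Proof.
have PD : linear P.
  move=> a u w; rewrite /P scaler_sumr -big_split /=.
  by apply: eq_bigr => s _; rewrite linearP.
have P0 : P 0 = 0 by rewrite /P big1 // => s _; rewrite linear0.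
have PB u w : P (u - w) = P u - P w.
  by rewrite addrC -scaleN1r PD scaleN1r addrC.
have [|||u eu] := @eigen_lift k m q X T hT hq predT (fun v => P v = 0) _ _ v.
- by split=> // a u w Pu Pw; rewrite PD Pu Pw scaler0 addr0.
- by move=> l lm u Pu; rewrite sum_perm_op_gen // Pu scaler0.
- move=> l lm _; rewrite PB sum_perm_op_gen //.
  by rewrite -[q *: v]addr0 PD P0 addr0 subrr.
rewrite PB => /subr0_eq E; rewrite rhoXE -E sum_perm_op_eigen // scalerK //.
exact: qfact_neq0.
Qed.

End RhoX.

(** * Operators on tensor powers *)

Section Lift.
Variables (k : fieldType) (n : nat).
Implicit Types (u v w t : seq 'I_n).

Lemma coordS_val m (f : TV k n m) (t : m.-tuple 'I_n) : coordS f t = f t.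
Proof. by rewrite /coordS (big_pred1 t). Qed.

Lemma coordS_ffun m (g : seq 'I_n -> k^o) w : size w = m ->
  coordS ([ffun t : m.-tuple 'I_n => g t] : TV k n m) w = g w.
Proof. by move=> /eqP sw; rewrite -[w]/(val (Tuple sw)) coordS_val ffunE. Qed.

Lemma coordS_eq m (f g : TV k n m) :
  (forall w, size w = m -> coordS f w = coordS g w) -> f = g.
Proof. by move=> h; apply/ffunP => t; rewrite -!coordS_val h ?size_tuple. Qed.

Lemma coordS_linear m w : linear (fun f : TV k n m => coordS f w).
Proof.
move=> a f g; rewrite /coordS scaler_sumr -big_split /=.
by apply: eq_bigr => t _; rewrite !ffunE.
Qed.

Lemma coordS_sum m (I : finType) (f : I -> TV k n m) w :
  coordS (\sum_i f i) w = \sum_i coordS (f i) w.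
Proof.
apply: (big_morph (fun f : TV k n m => coordS f w)) => [g h|]; last first.
  by rewrite /coordS big1 // => t _; rewrite ffunE.
by rewrite -[g in LHS]scale1r (coordS_linear w 1 g h) scale1r.
Qed.

Lemma coordSZ m c (f : TV k n m) w : coordS (c *: f) w = c * coordS f w.
Proof. by rewrite /coordS mulr_sumr; apply: eq_bigr => t _; rewrite ffunE. Qed.

Lemma coordS_apply a (F : 'End(TV k n a)) (f : TV k n a) w :
  coordS (F f) w = \sum_(s : a.-tuple 'I_n) f s * coefS F s w.
Proof.
have {1}-> : f = \sum_(s : a.-tuple 'I_n) f s *: deltaS k a s.
  apply/ffunP => t; rewrite sum_ffunE (bigD1 t) //= !ffunE eqxx big1 ?addr0.
    by rewrite /GRing.scale /= mulr1.
  by move=> s st; rewrite !ffunE val_eqE eq_sym (negbTE st) scaler0.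
rewrite linear_sum /=.
have E := coordS_sum (fun s : a.-tuple 'I_n => F (f s *: deltaS k a s)) w.
rewrite E.
by apply: eq_bigr => s _; rewrite linearZ coordSZ.
Qed.

Definition liftop_fun a (F : 'End(TV k n a)) m p (f : TV k n m) : TV k n m :=
  [ffun w : m.-tuple 'I_n => \sum_(w' : m.-tuple 'I_n | agree p a w' w)
     f w' * coefS F (window p a w') (window p a w)].

Fact liftop_fun_linear a (F : 'End(TV k n a)) m p : linear (@liftop_fun a F m p).
Proof.
move=> c f g; apply/ffunP => w; rewrite !ffunE scaler_sumr -big_split /=.
by apply: eq_bigr => w' _; rewrite !ffunE mulrDl -scalerAl.
Qed.
HB.instance Definition _ a (F : 'End(TV k n a)) m p :=
  GRing.isLinear.Build k (TV k n m) (TV k n m) _ (@liftop_fun a F m p) (liftop_fun_linear F p).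

Lemma liftopE a (F : 'End(TV k n a)) m p f : liftop F m p f = liftop_fun F p f.
Proof. by rewrite /liftop -/(liftop_fun F (m := m) p) lfunE. Qed.

Lemma agree_cat m p a u t v (w' : m.-tuple 'I_n) (s : a.-tuple 'I_n) :
  size u = p -> size t = a ->
  agree p a w' (u ++ t ++ v) && (val s == window p a w') = (val w' == u ++ s ++ v).
Proof.
move=> su st; rewrite /agree /window take_size_cat // drop_cat su ltnNge leq_addr /=.
rewrite addKn drop_size_cat //; apply/andP/eqP => [[/andP[/eqP e1 /eqP e2] /eqP ->]|->].
  rewrite -[LHS](cat_take_drop p) e1; congr (_ ++ _).
  by rewrite -[LHS](cat_take_drop a) drop_drop addnC e2.
rewrite take_size_cat // drop_cat su ltnNge leq_addr /= addKn.
by rewrite drop_size_cat ?size_tuple // !eqxx drop_size_cat // take_size_cat ?size_tuple.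
Qed.

Lemma coordS_liftop a (F : 'End(TV k n a)) m u t v (f : TV k n m) :
  size t = a -> (size u + (a + size v) = m)%N ->
  coordS (liftop F m (size u) f) (u ++ t ++ v) =
    \sum_(s : a.-tuple 'I_n) coordS f (u ++ s ++ v) * coefS F s t.
Proof.
move=> st sm; rewrite liftopE /liftop_fun.
have sw : size (u ++ t ++ v) = m by rewrite !size_cat st.
rewrite (coordS_ffun (fun w => \sum_(w' : m.-tuple 'I_n | agree (size u) a w' w)
     f w' * coefS F (window (size u) a w') (window (size u) a w))) //.
have -> : window (size u) a (u ++ t ++ v) = t.
  by rewrite /window drop_size_cat // take_size_cat.
under [RHS]eq_bigr do rewrite /coordS big_distrl.
rewrite (exchange_big_dep (fun w' : m.-tuple 'I_n => agree (size u) a w' (u ++ t ++ v))) /=; last first.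
  by move=> s w' _; rewrite -(@agree_cat _ (size u) a _ t) // => /andP[].
apply: eq_bigr => w' ag.
have sz : size (window (size u) a w') == a.
  by rewrite size_take size_drop size_tuple -sm addKn; case: ltnP => //; lia.
rewrite (big_pred1 (Tuple sz)) // => s.
by rewrite -(@agree_cat _ (size u) a _ t) // ag /=.
Qed.

(** Contraction with the basis words [u] on the left and [v] on the right. Operators acting inside
    the window act on slices, which reduces identities on long tensors to short ones. *)
Definition slice a m u v (f : TV k n m) : TV k n a :=
  [ffun t : a.-tuple 'I_n => coordS f (u ++ t ++ v)].

Lemma coordS_slice a m u v (f : TV k n m) t : size t = a ->
  coordS (slice a u v f) t = coordS f (u ++ t ++ v).
Proof. by move=> st; rewrite /slice (coordS_ffun (fun t => coordS f (u ++ t ++ v))). Qed.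

Fact slice_linear a m u v : linear (@slice a m u v).
Proof. by move=> c f g; apply/ffunP => t; rewrite !ffunE coordS_linear. Qed.
HB.instance Definition _ a m u v :=
  GRing.isLinear.Build k (TV k n m) (TV k n a) _ (@slice a m u v) (@slice_linear a m u v).

Lemma slice_eq a p m (f g : TV k n m) : (p + a <= m)%N ->
  (forall u v, size u = p -> (size u + (a + size v) = m)%N -> slice a u v f = slice a u v g) ->
  f = g.
Proof.
move=> pm h; apply: coordS_eq => w sw.
have su : size (take p w) = p by rewrite size_take sw; case: ltnP => //; lia.
have st : size (take a (drop p w)) = a.
  by rewrite size_take size_drop sw; case: ltnP => //; lia.
rewrite -[w](cat_take_drop p) -[drop p w](cat_take_drop a) -(coordS_slice _ _ f st) -(coordS_slice _ _ g st) h //.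
by rewrite su !size_drop sw; lia.
Qed.

Lemma slice_liftop a (F : 'End(TV k n a)) m u v (f : TV k n m) :
  (size u + (a + size v) = m)%N ->
  slice a u v (liftop F m (size u) f) = F (slice a u v f).
Proof.
move=> sm; apply/ffunP => t; rewrite ffunE coordS_liftop ?size_tuple //.
by rewrite -coordS_val coordS_apply; apply: eq_bigr => s _; rewrite ffunE.
Qed.

Lemma slice_slice b a m u v u' v' (f : TV k n m) : (size u' + (b + size v') = a)%N ->
  slice b u' v' (slice a u v f) = slice b (u ++ u') (v' ++ v) f.
Proof.
move=> sa; apply/ffunP => t; rewrite !ffunE coordS_slice ?catA //.
by rewrite !size_cat size_tuple -sa addnA.
Qed.

Lemma slice_liftop_sub b (F : 'End(TV k n b)) j a m u v (f : TV k n m) :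
  (j + b <= a)%N -> (size u + (a + size v) = m)%N ->
  slice a u v (liftop F m (size u + j) f) = liftop F a j (slice a u v f).
Proof.
move=> jb sm; apply: (@slice_eq b j) => // u' v' su' sa.
rewrite -su' slice_liftop // !slice_slice // -size_cat slice_liftop //.
by rewrite !size_cat; lia.
Qed.

Lemma liftop_comm a b (F : 'End(TV k n a)) (G : 'End(TV k n b)) m p p' (f : TV k n m) :
  (p + a <= p')%N -> (p' + b <= m)%N ->
  liftop F m p (liftop G m p' f) = liftop G m p' (liftop F m p f).
Proof.
move=> pa pb; apply: coordS_eq => w sw.
pose u := take p w; pose t := take a (drop p w).
pose x := take (p' - (p + a)) (drop (p + a) w); pose t' := take b (drop p' w).
pose y := drop (p' + b) w.
have su : size u = p by rewrite size_take sw; case: ltnP => //; lia.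
have st : size t = a by rewrite size_take size_drop sw; case: ltnP => //; lia.
have sx : size x = (p' - (p + a))%N by rewrite size_take size_drop sw; case: ltnP => //; lia.
have st' : size t' = b by rewrite size_take size_drop sw; case: ltnP => //; lia.
have sy : size y = (m - (p' + b))%N by rewrite size_drop sw.
(* Five blocks: the disjoint windows [t] and [t'] of the two operators, and the letters around
   them. *)
have -> : w = u ++ t ++ (x ++ t' ++ y).
  rewrite -{1}[w](cat_take_drop p) -{1}[drop p w](cat_take_drop a) drop_drop addnC.
  rewrite -{1}[drop (p + a) w](cat_take_drop (p' - (p + a))) drop_drop subnK //.
  by rewrite -{1}[drop p' w](cat_take_drop b) drop_drop [(b + p')%N]addnC.
have cat5 s : size s = a -> u ++ s ++ x ++ t' ++ y = (u ++ s ++ x) ++ t' ++ y.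
  by rewrite !catA.
have szl s : size s = a -> size (u ++ s ++ x) = p' by rewrite !size_cat su sx => ->; lia.
rewrite -su coordS_liftop //; last by rewrite !size_cat st' sx sy; lia.
rewrite [in RHS]cat5 // -[in RHS](szl t) // coordS_liftop //; last by rewrite szl // sy; lia.
transitivity (\sum_(s : a.-tuple 'I_n) \sum_(s' : b.-tuple 'I_n)
    coordS f (u ++ s ++ x ++ s' ++ y) * coefS G s' t' * coefS F s t).
  apply: eq_bigr => s _; rewrite cat5 ?size_tuple // -(szl s) ?size_tuple //.
  rewrite coordS_liftop //; last by rewrite szl ?size_tuple // sy; lia.
  by rewrite big_distrl; apply: eq_bigr => s' _; rewrite -!catA.
rewrite exchange_big; apply: eq_bigr => s' _ /=.
rewrite -!catA coordS_liftop //; last by rewrite !size_cat size_tuple sx sy; lia.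
by rewrite big_distrl; apply: eq_bigr => s _; rewrite mulrAC.
Qed.

Variables (q : k) (R : 'End(TV k n 2)).

(** On slices of width 2 and 3 the relations become those of [R]; distant generators act on disjoint
    windows. *)
Lemma rhoT_hecke n0 m : hecke_op n0 q R -> hecke_module m q (@rhoT k n m.+1 R).
Proof.
case=> _ /lfunP quad /lfunP braid; rewrite /rhoT.
have Rquad (f : TV k n 2) : R (R f) = (q - 1) *: R f + q *: f.
  have := quad f; rewrite comp_lfunE zero_lfunE add_lfunE id_lfunE add_lfunE opp_lfunE.
  rewrite scale_lfunE id_lfunE linearB linearZ /= => /eqP E.
  by apply/eqP; rewrite -subr_eq0 -(eqP E); apply/eqP; vect_ring.
split.
- move=> l lm f; apply: (@slice_eq 2 l) => [|u v su sm]; first by lia.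
  by rewrite -su linearP /= linearZ /= !slice_liftop // Rquad.
- move=> l lm f; apply: (@slice_eq 3 l) => [|u v su sm]; first by lia.
  have e0 g : slice 3 u v (liftop R m.+1 l g) = liftop R 3 0 (slice 3 u v g).
    by rewrite -su -[size u in LHS]addn0 slice_liftop_sub.
  have e1 g : slice 3 u v (liftop R m.+1 l.+1 g) = liftop R 3 1 (slice 3 u v g).
    by rewrite -su -[(size u).+1]addn1 slice_liftop_sub.
  by rewrite !(e0, e1); have := braid (slice 3 u v f); rewrite !comp_lfunE.
by move=> i j ij jm f; rewrite liftop_comm //; lia.
Qed.

(** The tensor e_u (x) r (x) e_v, with [u] and [v] the letters of [w0] before and after the
    window. *)
Definition elementary d a p (w0 : d.-tuple 'I_n) (r : TV k n a) : TV k n d :=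
  [ffun w : d.-tuple 'I_n => if agree p a w w0 then coordS r (window p a w) else 0].

Lemma liftop_elementary a (F : 'End(TV k n a)) d p (f : TV k n d) :
  liftop F d p f = \sum_(w0 : d.-tuple 'I_n) f w0 *: elementary p w0 (F (deltaS k a (window p a w0))).
Proof.
rewrite liftopE; apply/ffunP => w; rewrite ffunE sum_ffunE big_mkcond.
apply: eq_bigr => w0 _; rewrite !ffunE.
have -> : agree p a w w0 = agree p a w0 w by rewrite /agree !(eq_sym (take p w)) !(eq_sym (drop _ w)).
by case: ifP => _; rewrite ?scaler0.
Qed.

Lemma slice_elementary d a (w0 : d.-tuple 'I_n) (r : TV k n a) u v :
  (size u + (a + size v) = d)%N ->
  slice a u v (elementary (size u) w0 r) =
    if (u == take (size u) w0) && (v == drop (size u + a) w0) then r else 0.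
Proof.
move=> sd; apply/ffunP => t; rewrite ffunE.
have sw : size (u ++ t ++ v) = d by rewrite !size_cat size_tuple.
rewrite (coordS_ffun (fun w => if agree (size u) a w w0 then coordS r (window (size u) a w) else 0)) //.
have e1 : drop (size u) (u ++ t ++ v) = t ++ v by rewrite drop_size_cat.
have e2 : drop (size u + a) (u ++ t ++ v) = v.
  by rewrite addnC -drop_drop e1 drop_size_cat ?size_tuple.
rewrite /agree /window e1 e2 !take_size_cat ?size_tuple //.
by case: ifP => _; rewrite ?coordS_val // ffunE.
Qed.

Definition window_eigen m d p (v : TV k n d) :=
  forall l, (p <= l)%N -> (l < p + m)%N -> rhoT d R l v = q *: v.

Lemma elementary_eigen m d p (w0 : d.-tuple 'I_n) (r : TV k n m.+1) :
  (p + m.+1 <= d)%N -> eigen m q (rhoT m.+1 R) predT r -> window_eigen m p (elementary p w0 r).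
Proof.
move=> pd er l pl lm; apply: (@slice_eq m.+1 p) => // u v su sd.
rewrite -su in pl lm *; rewrite /rhoT -(subnKC pl) slice_liftop_sub //; last by lia.
rewrite linearZ /= slice_elementary //.
by case: ifP => _; [apply: er => //; lia | rewrite linear0 scaler0].
Qed.

(** The symmetrizer fixes eigenvectors, so applying it in the window leaves [v] unchanged while
    expanding it in tensors of relations. With [elementary_eigen] this identifies a space of
    relations with an eigenspace. *)
Lemma window_eigen_elementary m d p (v : TV k n d) : hecke_module m q (@rhoT k n m.+1 R) ->
  (forall r, (0 < r)%N -> qint q r != 0) ->
  (p + m.+1 <= d)%N -> window_eigen m p v ->
  v = \sum_(w0 : d.-tuple 'I_n)
     v w0 *: elementary p w0 (rhoX m.+1 q R (deltaS k m.+1 (window p m.+1 w0))).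
Proof.
move=> hT hq pd ev; rewrite -liftop_elementary.
apply: (@slice_eq m.+1 p) => // u w su sd; rewrite -su slice_liftop //.
rewrite (rhoX_eigen hq hT) // => l lm _; rewrite /rhoT -slice_liftop_sub //; last by lia.
by have := ev (size u + l)%N; rewrite /rhoT su => -> //; rewrite ?linearZ //; lia.
Qed.

End Lift.

(** * The bar complex *)

Section Bar.
Variables (k : fieldType) (d : nat) (X : vectType k).
Implicit Types (c : {set 'I_d}) (b t : 'I_d) (phi psi : {set 'I_d} -> X).

Definition below c b := #|[set y in c | (y < b)%N]|.

(** Chains are families of representatives indexed by cut sets; the relations [J c] enter only
    through [bar_cycle] and [homologous]. *)
Definition bar phi c : X :=
  \sum_(b | (b \notin c) && (val b != 0%N)) (-1) ^+ below c b *: phi (b |: c).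

Lemma barB phi psi c : bar (fun c => phi c - psi c) c = bar phi c - bar psi c.
Proof. by rewrite /bar -sumrB; apply: eq_bigr => b _; rewrite scalerBr. Qed.

Lemma belowU c b b' : b \notin c -> below (b |: c) b' = ((b < b')%N + below c b')%N.
Proof.
move=> bc; rewrite /below; case: ltnP => bb'.
  rewrite -[X in _ = (_ + X)%N]/#|[set y in c | (y < b')%N]|.
  have -> : [set y in b |: c | (y < b')%N] = b |: [set y in c | (y < b')%N].
    by apply/setP => y; rewrite !inE; case: eqVneq => [->|].
  by rewrite cardsU1 inE (negbTE bc).
rewrite add0n; apply: eq_card => y; rewrite !inE.
by case: eqVneq => [->|//]; rewrite (negbTE bc) ltnNge bb'.
Qed.

(** Adding two cuts in either order gives the same cut set with opposite signs. *)
Lemma bar_bar phi c : bar (bar phi) c = 0.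
Proof.
pose a b b' := if [&& b \notin c, b' \notin c, val b != 0%N, val b' != 0%N & b != b'] then
  (-1) ^+ (below c b + (b < b')%N + below c b') *: phi (b |: (b' |: c)) else 0.
have -> : bar (bar phi) c = \sum_b \sum_b' a b b'.
  rewrite /bar big_mkcond; apply: eq_bigr => b _.
  case: ifPn => [/andP[bc b0]|]; last first.
    by rewrite negb_and !negbK => h; rewrite big1 // => b' _; rewrite /a; case: ifP => // /and5P[h1 _ h2 _ _]; move: h; rewrite (negbTE h1) (negbTE h2).
  rewrite scaler_sumr big_mkcond; apply: eq_bigr => b' _.
  rewrite /a bc b0 /= !inE negb_or eq_sym; case: eqVneq => /=; rewrite ?andbF //= andbT.
  case: ifP => // _ _; rewrite scalerA -exprD belowU // addnA.
  by congr (_ *: phi _); rewrite setUCA.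
have asym b b' : a b b' = - a b' b.
  rewrite /a; have -> : [&& b' \notin c, b \notin c, val b' != 0%N, val b != 0%N & b' != b] =
      [&& b \notin c, b' \notin c, val b != 0%N, val b' != 0%N & b != b'].
    rewrite (eq_sym b' b); case: (b \notin c); case: (b' \notin c);
    by case: (val b != 0%N); case: (val b' != 0%N).
  case: ifPn => [/and5P[_ _ _ _ h5]|]; last by rewrite oppr0.
  rewrite setUCA -scaleNr; congr (_ *: _).
  have : (b < b')%N = ~~ (b' < b)%N by move: h5; rewrite -val_eqE /=; case: ltngtP.
  by move=> ->; case: (b' < b)%N; rewrite /= ?addn0 ?addn1 ?addSn addnC !exprS; ring.
have split b : \sum_b' a b b' = \sum_(b' : 'I_d | (b < b')%N) a b b' + \sum_(b' : 'I_d | (b' < b)%N) a b b'.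
  rewrite (bigID (fun b' : 'I_d => b < b')%N) /=; congr (_ + _).
  rewrite (bigD1 b) ?ltnn //= /a eqxx !andbF add0r; apply: eq_bigl => b'.
  by rewrite -leqNgt -val_eqE ltn_neqAle andbC.
under eq_bigr do rewrite split.
rewrite big_split /= [X in _ + X](exchange_big_dep predT) //= -big_split big1 // => b _.
by rewrite -big_split big1 // => b' _; rewrite /= asym addNr.
Qed.

Definition supported i phi := forall c, ~~ validc i c -> phi c = 0.

Lemma validc_cons i c b : b \notin c -> val b != 0%N -> validc i.+1 (b |: c) = validc i c.
Proof.
move=> bc b0; rewrite /validc cardsU1 bc eqSS; congr (_ && _).
apply/forallP/forallP => h x; apply/implyP => x0; have := h x; rewrite x0 /= !inE.
  by case: eqVneq => [xb|//]; move: b0; rewrite -xb x0.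
by move=> ->; rewrite orbT.
Qed.

Lemma supported_bar i phi : supported i.+1 phi -> supported i (bar phi).
Proof.
move=> h c vc; rewrite /bar big1 // => b /andP[bc b0].
by rewrite h ?scaler0 // validc_cons.
Qed.

Variable J : {set 'I_d} -> X -> Prop.
Hypotheses (hJ : forall c, submodule (J c))
  (Jmono : forall c c' v, c \subset c' -> J c' v -> J c v).

Lemma J_bar phi : (forall c, J c (phi c)) -> forall c, J c (bar phi c).
Proof.
move=> h c; apply: submodule_sum => // b _; apply: submoduleZ => //.
by apply: (@Jmono _ (b |: c)) => //; apply: subsetUr.
Qed.

Definition bar_cycle phi := forall c, J c (bar phi c).

Definition homologous i phi phi' :=
  exists2 psi, supported i.+1 psi & forall c, J c (phi c - bar psi c - phi' c).

Lemma homologous_trans i phi1 phi2 phi3 :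
  homologous i phi1 phi2 -> homologous i phi2 phi3 -> homologous i phi1 phi3.
Proof.
move=> [psi s1 h1] [psi' s2 h2].
exists (fun c => psi c + psi' c) => [c vc|c]; first by rewrite s1 ?s2 ?addr0.
have -> : bar (fun c => psi c + psi' c) c = bar psi c + bar psi' c.
  by rewrite /bar -big_split; apply: eq_bigr => b _; rewrite scalerDr.
have := submoduleD (hJ c) (h1 c) (h2 c).
suff -> : forall a b e f g : X, a - b - e + (e - f - g) = a - (b + f) - g by [].
by move=> a b e f g; vect_ring.
Qed.

Lemma bar_cycle_congr phi phi' : (forall c, J c (phi c - phi' c)) -> bar_cycle phi -> bar_cycle phi'.
Proof.
move=> h cy c; rewrite -[bar phi' c](subKr (bar phi c)) -barB.
by apply: submoduleB => //; apply: J_bar.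
Qed.

(* Filling with [psi (t |: c) = +- phi c] kills all components not cut at [t]. *)
Lemma toggle i phi t (S : X -> Prop) : submodule S -> val t != 0%N ->
  supported i phi -> bar_cycle phi -> (forall c, S (phi c)) ->
  exists phi', [/\ homologous i phi phi', supported i phi', bar_cycle phi' /\ forall c, S (phi' c),
    forall c, t \notin c -> phi' c = 0 &
    forall c, t \in c -> J (c :\ t) (phi' c) /\
      (phi' c != 0 -> phi c != 0 \/ exists b, [/\ b \notin c, val b != 0%N & phi ((b |: c) :\ t) != 0])].
Proof.
move=> hS t0 sphi cphi Sphi.
pose psi c := if t \in c then (-1) ^+ below c t *: phi (c :\ t) else 0.
have spsi : supported i.+1 psi.
  move=> c vc; rewrite /psi; case: ifP => // tc; rewrite sphi ?scaler0 //.
  by rewrite -(@validc_cons i (c :\ t) t) ?setD1K // !inE eqxx.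
pose phi' c := phi c - bar psi c.
have phi0 c : t \notin c -> phi' c = 0.
  move=> tc; rewrite /phi' /bar (bigD1 t) /=; last by rewrite tc.
  rewrite big1 ?addr0 => [|b /andP[/andP[bc b0] bt]]; last first.
    by rewrite /psi !inE eq_sym (negbTE bt) (negbTE tc) scaler0.
  by rewrite /psi setU11 belowU // ltnn setU1K // scalerA -exprD addnn -signr_odd odd_double scale1r subrr.
have cphi' : bar_cycle phi'.
  by move=> c; rewrite barB bar_bar subr0.
exists phi'; split=> //.
- by exists psi => // c; rewrite subrr; exact: submodule0.
- by move=> c vc; rewrite /phi' sphi // (supported_bar spsi) // subr0.
- split=> // c; apply: submoduleB => //; apply: submodule_sum => // b _; apply: submoduleZ => //.
  by rewrite /psi; case: ifP => _; [apply: submoduleZ | apply: submodule0].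
move=> c tc; split.
  (* In the boundary at [c :\ t] only the term restoring [t] survives, so the cycle condition makes
     [phi' c] a relation there. *)
  have := cphi' (c :\ t); rewrite /bar (bigD1 t) /=; last by rewrite !inE eqxx.
  rewrite big1 ?addr0 => [|b /andP[/andP[bc b0] bt]]; last first.
    by rewrite phi0 ?scaler0 // !inE eqxx eq_sym (negbTE bt).
  rewrite setD1K // => /(submoduleZ (hJ _) ((-1) ^+ below (c :\ t) t)).
  by rewrite scalerA -exprD addnn -signr_odd odd_double scale1r.
move=> nz; have [p0|] := eqVneq (phi c) 0; last by left.
have [/existsP[b /and3P[h1 h2 h3]]|/existsPn h] :=
  boolP [exists b, [&& b \notin c, val b != 0%N & phi ((b |: c) :\ t) != 0]].
  by right; exists b.
case/eqP: nz; rewrite /phi' p0 sub0r; apply/eqP; rewrite oppr_eq0; apply/eqP; rewrite /bar big1 // => b /andP[bc b0].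
have := h b; rewrite /psi !inE tc orbT bc b0 /= negbK => /eqP ->.
by rewrite !scaler0.
Qed.

End Bar.

(** * Acyclicity of the bar complex outside the degrees nu_N(i) *)

Section Acyclic.
Variables (k : fieldType) (m N' : nat) (q : k) (X : vectType k) (T : nat -> 'End(X)).
Hypotheses (q0 : q != 0) (hq : forall r, (0 < r)%N -> qint q r != 0).
Hypotheses (hT : hecke_module m q T) (N'_gt0 : (0 < N')%N).
Local Notation d := m.+1.
Local Notation N := N'.+1.
Implicit Types (c : {set 'I_d}) (b t : 'I_d) (phi psi : {set 'I_d} -> X).

Definition uncut c p := (p + N <= d)%N && inblock N c p.
(** The [N] tensor factors starting at [p] carry only [N' = N - 1] generators. *)
Definition window_pred p : pred nat := [pred l | (p <= l)%N && (l < p + N')%N].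

Definition blockrel c (v : X) := exists x : 'I_d.+1 -> X,
  [/\ forall p : 'I_d.+1, eigen m q T (window_pred p) (x p),
    forall p : 'I_d.+1, ~~ uncut c p -> x p = 0 & v = \sum_p x p].

Lemma uncutP c p : reflect ((p + N <= d)%N /\ forall b, b \in c -> ~ (p < b < p + N)%N) (uncut c p).
Proof.
apply: (iffP andP) => -[pd h]; split=> //.
  by move=> b bc; apply/negP; apply: (implyP (forallP h b)).
by apply/forallP => b; apply/implyP => bc; apply/negP/h.
Qed.

Lemma blockrel_submodule c : submodule (blockrel c).
Proof.
split=> [|a u v [x [x1 x2 ->]] [y [y1 y2 ->]]].
  exists (fun=> 0); split=> // [p|]; [exact: eigen0 | by rewrite big1].
exists (fun p => a *: x p + y p); split.
- by move=> p l lm Dl; rewrite linearP /= x1 // y1 // scalerDr !scalerA mulrC.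
- by move=> p up; rewrite x2 ?y2 // scaler0 addr0.
by rewrite scaler_sumr -big_split.
Qed.

Lemma uncut_sub c c' p : c \subset c' -> uncut c' p -> uncut c p.
Proof.
move=> /subsetP sub /uncutP[pd h]; apply/uncutP; split=> // b /sub; exact: h.
Qed.

Lemma blockrel_sub c c' v : c \subset c' -> blockrel c' v -> blockrel c v.
Proof.
move=> sub [x [x1 x2 ->]]; exists x; split=> // p up; apply: x2.
by apply: contra up; apply: uncut_sub.
Qed.

Definition initial (b : nat) : X -> Prop := eigen m q T (fun l => l < b)%N.

Lemma initial_submodule (b : nat) : submodule (initial b).
Proof.
split=> [|a u v hu hv]; first exact: eigen0.
by move=> l lm Dl; rewrite linearP /= hu // hv // scalerDr !scalerA mulrC.
Qed.

(** Distributivity splits [v] into terms that are eigenvectors both for the generators below [b] and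
    for one window. Windows uncut in [c] give relations for [c]. A window opened by removing the cut
    [t] contains the generator [b], which acts across that cut, so its term goes into [h]. *)
Lemma blockrel_initial c (t : 'I_d) (v : X) (b : nat) : t = b.+1 :> nat -> t \in c ->
  initial b v -> blockrel (c :\ t) v ->
  exists2 h, initial b.+1 h & blockrel c (v - h).
Proof.
move=> tb tc bv [x [x1 x2 xE]].
(* At a cut window the vector is zero, an eigenvector for all generators; [predT] puts the
   corresponding term into [h]. *)
pose D j : pred nat := if j is p.+1 then if uncut (c :\ t) p then window_pred p else predT
  else fun l => (l < b)%N.
pose y j := if j is p.+1 then - x (inord p) else v.
have zero_stable : stable_submodule m T (fun v : X => v = 0).
  split; last by move=> l _ u ->; rewrite linear0.
  by split=> // a u w -> ->; rewrite scaler0 addr0.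
have [||u eu /subr0_eq vE] := @eigen_dist k m q q0 hq d.+1 X T _ hT zero_stable D y.
- case=> [_|p pd]; first exact: bv.
  rewrite /D /y; case: ifPn => up.
    by apply: eigenN; have := x1 (inord p); rewrite inordK.
  by rewrite x2 ?inordK // oppr0; apply: eigen0.
- rewrite big_ord_recl (eq_bigr (fun p : 'I_d.+1 => - x p)) => [|p _].
    by rewrite sumrN [y _]/= -xE subrr.
  by rewrite lift0 /y inord_val.
exists (\sum_(p < d.+1 | ~~ uncut c p) u p).
  apply: eigen_sum => p up; apply: eigen_sub (eu p (ltn_ord p)) => l /=.
  rewrite ltnS leq_eqVlt => /orP[/eqP ->|->//]; apply/orP; right.
  case: ifPn => // /uncutP[pd h]; rewrite /window_pred inE.
  have {up} : (p < t < p + N)%N.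
    apply/negPn/negP => /negP pt; case/negP: up; apply/uncutP; split=> // b' b'c.
    by have [->//|b't] := eqVneq b' t; apply: h; rewrite !inE b't.
  by rewrite tb; lia.
exists (fun p : 'I_d.+1 => if uncut c p then u p else 0); split.
- move=> p; case: ifP => up; last exact: eigen0.
  apply: eigen_sub (eu p (ltn_ord p)) => l /= wl; apply/orP; right.
  by rewrite (uncut_sub _ up) ?subsetDl.
- by move=> p /negbTE ->.
rewrite [y 0%N]/= in vE; rewrite vE (bigID (fun p : 'I_d.+1 => uncut c p)) /= addrK.
by rewrite big_mkcond.
Qed.

Local Notation homologous := (homologous blockrel).
Local Notation bar_cycle := (bar_cycle blockrel).

Lemma homologous_congr i phi phi' : (forall c, blockrel c (phi c - phi' c)) ->
  homologous i phi phi'.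
Proof.
move=> h; exists (fun=> 0) => // c; rewrite /bar big1 ?subr0 // => b _.
by rewrite scaler0.
Qed.

(** After toggling [b.+1] every nonzero component is cut there and is a relation once this cut is
    removed, so [blockrel_initial] gains one more generator. *)
Lemma homologous_initial i phi (b : nat) : (b <= m)%N -> supported i phi -> bar_cycle phi ->
  exists phi', [/\ homologous i phi phi', supported i phi', bar_cycle phi' &
    forall c, initial b (phi' c)].
Proof.
elim: b => [|b IH] bm sphi cphi.
  exists phi; split=> //.
  by apply: homologous_congr => c; rewrite subrr; apply: submodule0; apply: blockrel_submodule.
have [phi1 [h1 s1 c1 b1]] := IH (ltnW bm) sphi cphi.
have t0 : val (inord b.+1 : 'I_d) != 0%N by rewrite /= inordK.
have [phi2 [h2 s2 [c2 b2] z2 t2]] :=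
  toggle blockrel_submodule (initial_submodule b) t0 s1 c1 b1.
have /fin_all_exists[h hP] c : exists h, [/\ initial b.+1 h, blockrel c (phi2 c - h) & validc i c \/ h = 0].
  have J0 : blockrel c 0 by apply: submodule0; apply: blockrel_submodule.
  have [vc|vc] := boolP (validc i c); last first.
    by exists 0; rewrite s2 // subr0; split=> //; [apply: eigen0 | right].
  have [tc|tc] := boolP (inord b.+1 \in c); last first.
    by exists 0; rewrite z2 // subr0; split=> //; [apply: eigen0 | left].
  have te : (inord b.+1 : 'I_d) = b.+1 :> nat by rewrite inordK.
  have [h ih Jh] := blockrel_initial te tc (b2 c) (proj1 (t2 c tc)).
  by exists h; split=> //; left.
exists h; split.
- apply: homologous_trans blockrel_submodule _ _ _ _ h1 _.
  apply: homologous_trans blockrel_submodule _ _ _ _ h2 _.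
  by apply: homologous_congr => c; case: (hP c).
- by move=> c vc; case: (hP c) => _ _ []; rewrite ?(negbTE vc).
- by apply: (bar_cycle_congr blockrel_submodule blockrel_sub _ c2) => c; case: (hP c).
by move=> c; case: (hP c).
Qed.

(* Up to [a], the cuts are those of the composition [1 + (N-1) + 1 + (N-1) + ...]. *)
Definition alternating a c :=
  [forall y : 'I_d, (y <= a)%N ==> ((y \in c) == (y %% N <= 1)%N)].

Lemma alternatingP a c :
  reflect (forall y : 'I_d, (y <= a)%N -> (y \in c) = (y %% N <= 1)%N) (alternating a c).
Proof.
by apply: (iffP forallP) => h y; [move=> ya; apply/eqP/(implyP (h y)) | apply/implyP => /h ->].
Qed.

(** On common eigenvectors the complex is that of k[x]/(x^N): a component is a relation as soon as
    some block has length at least [N]. By [no_uncut_blockrel] there are no nonzero relations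
    otherwise. *)
Lemma initial_uncut c p v : initial m v -> uncut c p -> blockrel c v.
Proof.
move=> iv up; have pd : (p < d.+1)%N by case/uncutP: up; lia.
exists (fun p' : 'I_d.+1 => if p' == Ordinal pd then v else 0); split.
- move=> p'; case: ifP => _; last exact: eigen0.
  by move=> l lm _; exact: iv.
- by move=> p' up'; case: eqP => // e; move: up'; rewrite e up.
by rewrite -big_mkcond big_pred1_eq.
Qed.

Lemma no_uncut_blockrel c v : (forall p, ~~ uncut c p) -> blockrel c v -> v = 0.
Proof. by move=> nu [x [_ x0 ->]]; rewrite big1 // => p _; apply: x0. Qed.

(** Dropping one cut of 1 + (N-1) + 1 + (N-1) + ... joins a part 1 and a part N-1 into an open
    window of length [N]. It starts at the cut preceding [b]. *)
Lemma missing_cut_uncut j c b : (j * N < d)%N -> (b <= j * N)%N -> val b != 0%N ->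
  b \notin c -> (b %% N <= 1)%N ->
  (forall y : 'I_d, (y <= j * N)%N -> y != b -> (y \in c) = (y %% N <= 1)%N) ->
  exists p, uncut c p.
Proof.
move=> jd bj b0 bc bN h.
have modE (i r : nat) : (r < N)%N -> ((i * N + r) %% N = r)%N by move=> rN; rewrite modnMDl modn_small.
have bE := divn_eq b N; set e := (b %/ N)%N in bE.
case: (b %% N)%N bN bE => [|[|//]] _ bE.
  have e0 : (0 < e)%N by case: e bE => // bE; move: b0; rewrite /= bE.
  exists (e.-1 * N).+1; have bE' : b = (e.-1 * N + N)%N :> nat by rewrite /= bE -mulSnr prednK // addn0.
  apply/uncutP; split=> [|y yc]; first by lia.
  have [yb|yb] := eqVneq y b; first by move: bc; rewrite -yb yc.
  move=> yp; have yj : (y <= j * N)%N by rewrite /= in bE'; lia.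
  have yE : (y %% N = y - e.-1 * N)%N.
    by rewrite -{1}(@subnKC (e.-1 * N) y) ?modE //; move: yb; rewrite -val_eqE /=; lia.
  by have := h y yj yb; rewrite yc yE; move: yb; rewrite -val_eqE /=; lia.
have ej : (e < j)%N by rewrite -(ltn_pmul2r (ltn0Sn N')); lia.
exists (e * N)%N; have ejN : (e * N + N <= j * N)%N by rewrite -mulSnr leq_mul2r ej orbT.
apply/uncutP; split=> [|y yc yp]; first by lia.
have [yb|yb] := eqVneq y b; first by move: bc; rewrite -yb yc.
have yj : (y <= j * N)%N by lia.
have yE : (y %% N = y - e * N)%N by rewrite -{1}(@subnKC (e * N) y) ?modE //; lia.
by have := h y yj yb; rewrite yc yE; move: yb; rewrite -val_eqE /=; lia.
Qed.

(** The cut [j * N + 1] is toggled and components with an open window are discarded as relations. A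
    surviving component must acquire an open window when this cut is removed. That window starts at
    [j * N], which excludes other cuts before the next multiple of [N]; that multiple is a cut if it
    is below [d], since otherwise a window at [j * N + 1] would be open. *)
Lemma alternating_step i phi j : ((j * N).+2 <= d)%N -> supported i phi -> bar_cycle phi ->
  (forall c, initial m (phi c)) -> (forall c, phi c != 0 -> alternating (j * N) c) ->
  exists phi', [/\ homologous i phi phi', supported i phi', bar_cycle phi',
    forall c, initial m (phi' c) &
    forall c, phi' c != 0 -> (j.+1 * N <= d)%N && alternating (j.+1 * N) c].
Proof.
move=> jd sphi cphi iphi aphi.
have t0 : val (inord (j * N).+1 : 'I_d) != 0%N by rewrite /= inordK.
have te : (inord (j * N).+1 : 'I_d) = (j * N).+1 :> nat by rewrite inordK.
move: (inord _) t0 te => t t0 te.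
have [phi1 [h1 s1 [c1 i1] z1 t1]] :=
  toggle blockrel_submodule (initial_submodule m) t0 sphi cphi iphi.
pose P c := (j.+1 * N <= d)%N && alternating (j.+1 * N) c.
pose h c := if P c then phi1 c else 0.
have J0 c : blockrel c 0 by apply: submodule0; apply: blockrel_submodule.
have hJ c : blockrel c (phi1 c - h c).
  rewrite /h; case: ifPn => [_|nP]; first by rewrite subrr.
  rewrite subr0; have [->//|nz] := eqVneq (phi1 c) 0.
  have [/existsP[p up]|/existsPn nu] := boolP [exists p : 'I_d.+1, uncut c p].
    exact: initial_uncut up.
  have {}nu p : ~~ uncut c p.
    apply/negP => up; have pd : (p < d.+1)%N by case/uncutP: up; lia.
    by move: (nu (Ordinal pd)); rewrite up.
  have tc : t \in c by apply: contraNT nz => /z1 ->.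
  have [Jt why] := t1 c tc.
  (* If a cut [b] at most [j * N] had to be added to reach a component of [phi], its absence from
     [c] would open a window. *)
  have alt : alternating (j * N) c.
    have [/aphi//|[b [bc b0 /aphi/alternatingP alt]]] := why nz.
    have [bj|bj] := leqP b (j * N)%N; last first.
      apply/alternatingP => y yj; rewrite -alt // !inE.
      have -> : y != t by rewrite -val_eqE /= te; lia.
      by have /negbTE -> : y != b by rewrite -val_eqE /=; lia.
    have bt : b != t by rewrite -val_eqE /= te; lia.
    have [||p up] := @missing_cut_uncut j c b (ltnW jd) bj b0 bc _ _.
    - by rewrite -alt // !inE bt eqxx.
    - move=> y yj yb; rewrite -alt // !inE (negbTE yb) /=.
      by have -> : y != t by rewrite -val_eqE /= te; lia.
    by move: (nu p); rewrite up.
  have [/existsP[p up]|/existsPn nu'] := boolP [exists p : 'I_d.+1, uncut (c :\ t) p]; last first.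
    case/eqP: nz; apply: (no_uncut_blockrel _ Jt) => p.
    apply/negP => up; have pd : (p < d.+1)%N by case/uncutP: up; lia.
    by move: (nu' (Ordinal pd)); rewrite up.
  have [pd pc] := uncutP _ _ up.
  have pt : (p < t < p + N)%N.
    apply/negPn/negP => /negP pt; case/negP: (nu p); apply/uncutP; split=> // b bc.
    by have [->//|bt] := eqVneq b t; apply: pc; rewrite !inE bt.
  have ad : (j * N < d)%N by lia.
  have ac : Ordinal ad \in c by rewrite (alternatingP _ _ alt) //= modnMl.
  have pa : val p = (j * N)%N.
    have : ~ (p < Ordinal ad < p + N)%N by apply: pc; rewrite !inE ac -val_eqE /= te; lia.
    by rewrite /=; lia.
  rewrite /= in pa; case/negP: nP; rewrite /P mulSnr -pa pd /=; apply/alternatingP => y ya.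
  have modE r : (r < N)%N -> ((j * N + r) %% N = r)%N by move=> rN; rewrite modnMDl modn_small.
  have [yj|yj] := leqP y (j * N)%N; first exact: (alternatingP _ _ alt).
  have [yt|yt] := eqVneq y t; first by rewrite yt tc te -addn1 modE.
  have ynt : (y : nat) != (j * N).+1 by rewrite -te.
  have [yN|yN] := ltnP y (p + N)%N.
    have -> : (y \in c) = false.
      by apply/negP => yc; apply: (pc y); rewrite ?inE ?yt //; lia.
    have -> : (y %% N = y - j * N)%N by rewrite -{1}(@subnKC (j * N) y) ?modE //; lia.
    by apply/esym/negbTE; rewrite -ltnNge; lia.
  have yE : y = (j * N + N)%N :> nat by lia.
  rewrite yE modnDr modnMl /=; apply/idPn => yc.
  case/negP: (nu (j * N).+1); apply/uncutP; split=> [|b bc bp].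
    by have := ltn_ord y; rewrite yE; lia.
  have bt : b != t by rewrite -val_eqE /= te; lia.
  have by_ : b != y by apply: contraNneq yc => <-.
  by apply: (pc b); rewrite ?inE ?bt //; move: by_; rewrite -val_eqE /= yE; lia.
exists h; split.
- apply: homologous_trans blockrel_submodule _ _ _ _ h1 _.
  exact: homologous_congr.
- by move=> c vc; rewrite /h s1 //; case: ifP.
- exact: (bar_cycle_congr blockrel_submodule blockrel_sub hJ c1).
- by move=> c; rewrite /h; case: ifP => _; [apply: i1 | apply: eigen0].
by move=> c; rewrite /h; case: ifP => //; rewrite eqxx.
Qed.

Lemma sum_alternating j r : (r <= N)%N ->
  (\sum_(0 <= y < j * N + r) (y %% N <= 1) = j.*2 + minn r 2)%N.
Proof.
elim: j r => [|j IHj] r; last first.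
  move=> rN; elim: r rN => [|r IH] rN.
    by rewrite addn0 mulSnr IHj // doubleS; lia.
  rewrite addnS big_nat_recr //= IH; last by lia.
  by rewrite modnMDl modn_small //; lia.
elim: r => [|r IH] rN; first by rewrite big_geq.
rewrite mul0n add0n big_nat_recr //=; rewrite mul0n add0n in IH; rewrite IH; last by lia.
by rewrite modn_small //; lia.
Qed.

Lemma alternating_card j r c : (r <= 1)%N -> d = (j * N + r)%N -> alternating (j * N) c ->
  #|c| = (j.*2 + r)%N.
Proof.
move=> r1 dE /alternatingP alt.
have -> : (j.*2 + r = j.*2 + minn r 2)%N by lia.
rewrite -sum_alternating -?dE; last by lia.
rewrite -sum1_card big_mkcond big_mkord; apply: eq_bigr => y _.
by rewrite alt; [case: leqP | have := ltn_ord y; lia].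
Qed.

(** Once the values are common eigenvectors, the alternating pattern is extended [N] places at a
    time, until at most one place remains beyond [j * N]. Counting the cuts of a surviving component
    then gives d = nu_N(i), contrary to the hypothesis. *)
Theorem bar_acyclic i phi : d != nuN N i -> supported i phi -> bar_cycle phi ->
  exists2 psi, supported i.+1 psi & forall c, blockrel c (phi c - bar psi c).
Proof.
move=> di sphi cphi.
suff [psi sp hp] : homologous i phi (fun=> 0).
  by exists psi => // c; have := hp c; rewrite subr0.
have [phi1 [h1 s1 c1 i1]] := homologous_initial (leqnn m) sphi cphi.
apply: homologous_trans blockrel_submodule _ _ _ _ h1 _.
have zero psi : (forall c, psi c = 0) -> homologous i psi (fun=> 0).
  move=> p0; apply: homologous_congr => c; rewrite p0 subrr.
  by apply: submodule0; apply: blockrel_submodule.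
have short j psi : supported i psi -> (forall c, psi c != 0 -> (j * N <= d)%N && alternating (j * N) c) ->
    (d < (j * N).+2)%N -> homologous i psi (fun=> 0).
  move=> sp ap dj; apply: zero => c; apply/eqP; apply: contraNT di => nz.
  have /andP[jd alt] := ap c nz.
  have /andP[/eqP ci _] : validc i c by apply: contraNT nz => /sp ->.
  have := @alternating_card j (d - j * N) c ltac:(lia) ltac:(lia) alt.
  rewrite ci /nuN => ->; have [r0|r1] : (d - j * N = 0 \/ d - j * N = 1)%N by lia.
    by rewrite r0 addn0 odd_double doubleK eqn_leq jd -subn_eq0 r0.
  by rewrite r1 addn1 /= odd_double uphalf_double -r1 subnKC.
suff main e j psi : (d - j * N <= e)%N -> supported i psi -> bar_cycle psi ->
    (forall c, initial m (psi c)) ->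
    (forall c, psi c != 0 -> (j * N <= d)%N && alternating (j * N) c) ->
    homologous i psi (fun=> 0).
  apply: (main d 0%N) => // c nz.
  have : validc i c by apply: contraNT nz => /s1 ->.
  case/andP=> _ /forallP c0; apply/alternatingP => y; rewrite leqn0 => /eqP y0.
  by rewrite (implyP (c0 y)) /= y0 ?mod0n.
elim: e j psi => [|e IH] j psi je sp cp ip ap; have [jd|jd] := leqP (j * N).+2 d.
- lia.
- exact: short jd.
- have [psi' [h2 s2 c2 i2 a2]] := alternating_step jd sp cp ip (fun c nz => proj2 (andP (ap c nz))).
  apply: homologous_trans blockrel_submodule _ _ _ _ h2 _.
  by apply: (IH j.+1) => //; lia.
exact: short jd.
Qed.

End Acyclic.

(** * Comparison with the spaces of cycles and boundaries *)

Lemma sumv_submodule (k : fieldType) (V : vectType k) (Z : V -> Prop) (I : Type)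
    (r : seq I) (P : pred I) (W : I -> {vspace V}) : submodule Z ->
  (forall i, P i -> forall v, v \in W i -> Z v) ->
  forall v, v \in (\sum_(i <- r | P i) W i)%VS -> Z v.
Proof.
move=> hZ h; elim/big_rec: _ => [v|i U Pi IH v /memv_addP[u uW [w wU ->]]].
  by rewrite memv0 => /eqP ->; apply: submodule0.
by apply: submoduleD => //; [apply: h uW | apply: IH].
Qed.

Section Glue.
Variables (k : fieldType) (n m N' : nat) (q : k) (R : 'End(TV k n 2)).
Local Notation d := m.+1.
Local Notation N := N'.+1.
Hypotheses (q0 : q != 0) (hq : forall r, (0 < r)%N -> qint q r != 0) (N'_gt0 : (0 < N')%N).
Hypotheses (hTd : hecke_module m q (@rhoT k n d R)) (hTN : hecke_module N' q (@rhoT k n N R)).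
Local Notation Rel := (relX N q R).
Local Notation blockrel := (@blockrel k m N' q (TV k n d) (@rhoT k n d R)).
Implicit Types (f g : Amb k n d) (c : {set 'I_d}).

Definition component f c : TV k n d := [ffun w => f (c, w)].
Definition of_components (phi : {set 'I_d} -> TV k n d) : Amb k n d := [ffun x => phi x.1 x.2].

Lemma of_componentsK phi c : component (of_components phi) c = phi c.
Proof. by apply/ffunP => w; rewrite !ffunE. Qed.

Lemma componentsP f g : (forall c, component f c = component g c) -> f = g.
Proof. by move=> h; apply/ffunP => -[c w]; have /ffunP/(_ w) := h c; rewrite !ffunE. Qed.

Lemma componentP a f g c : component (a *: f + g) c = a *: component f c + component g c.
Proof. by apply/ffunP => w; rewrite !ffunE. Qed.

Lemma component0 c : component 0 c = 0.
Proof. by apply/ffunP => w; rewrite !ffunE. Qed.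

Definition barD_fun f : Amb k n d := [ffun x : {set 'I_d} * d.-tuple 'I_n =>
  \sum_(b : 'I_d | (b \notin x.1) && (val b != 0%N))
     (-1) ^+ #|[set y in x.1 | (y < b)%N]| * f (b |: x.1, x.2)].

Fact barD_fun_linear : linear barD_fun.
Proof.
move=> a f g; apply/ffunP => x; rewrite !ffunE scaler_sumr -big_split /=.
by apply: eq_bigr => b _; rewrite !ffunE mulrDr -scalerAr.
Qed.
HB.instance Definition _ := GRing.isLinear.Build k (Amb k n d) (Amb k n d) _ barD_fun barD_fun_linear.

Lemma component_barD f c : component (barD k n d f) c = bar (component f) c.
Proof.
rewrite /barD -/barD_fun lfunE /=; apply/ffunP => w; rewrite !ffunE sum_ffunE.
by apply: eq_bigr => b _; rewrite !ffunE.
Qed.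

Lemma mem_Ch i f : f \in Ch k n i d <-> supported i (component f).
Proof.
split=> [|sf].
  apply: (sumv_submodule (Z := fun f => supported i (component f))) => [|[c w] /= vc v /vlineP[a ->] c' vc'].
    split=> [c _|a u v su sv c vc]; first exact: component0.
    by rewrite componentP su ?sv // scaler0 addr0.
  apply/ffunP => w'; rewrite !ffunE; case: eqP => [[e _]|_]; last by rewrite scaler0.
  by move: vc'; rewrite e vc.
have -> : f = \sum_(x | validc i x.1) f x *: deltaB k x.
  apply/ffunP => -[c w]; rewrite sum_ffunE.
  have [vc|vc] := boolP (validc i c).
    rewrite (bigD1 (c, w)) //= !ffunE eqxx big1 ?addr0 => [|x /andP[_ xc]].
      by rewrite /GRing.scale /= mulr1.
    by rewrite !ffunE eq_sym (negbTE xc) scaler0.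
  have /ffunP/(_ w) := sf c vc; rewrite !ffunE => ->; rewrite big1 // => x vx.
  by rewrite !ffunE; case: eqP => [e|_]; [move: vc; rewrite -e in vx; rewrite vx | rewrite scaler0].
apply: memv_suml => x vx; apply: (subvP (sumv_sup x vx (subvv _))).
by rewrite memvZ // memv_line.
Qed.

Lemma component_Jgen c0 c p (w0 : d.-tuple 'I_n) (r : TV k n N) :
  component (Jgen c0 p w0 r) c = if c == c0 then elementary p w0 r else 0.
Proof. by apply/ffunP => w; rewrite !ffunE /=; case: eqP => _; rewrite ffunE. Qed.

Lemma Jrel_blockrel i f c : f \in Jrel Rel i d -> blockrel c (component f c).
Proof.
pose P (f : Amb k n d) := forall c, blockrel c (component f c).
suff main g : g \in Jrel Rel i d -> P g by move=> /main.
clear f c; move: g.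
have hB c' := @blockrel_submodule k m N' q (TV k n d) (@rhoT k n d R) c'.
have hP : submodule P.
  split=> [c|a u v hu hv c]; first by rewrite component0; apply: submodule0.
  by rewrite componentP; case: (hB c) => _; apply.
apply: (sumv_submodule (Z := P)) => // c0 vc0; apply: (sumv_submodule (Z := P)) => // p /andP[pd ib].
apply: (sumv_submodule (Z := P)) => // w0 _; rewrite big_seq.
apply: (sumv_submodule (Z := P)) => // r rR v /vlineP[a ->].
suff PJ : P (Jgen c0 p w0 r) by apply: (submoduleZ hP).
move=> c; rewrite component_Jgen; case: eqP => [->|_]; last exact: (submodule0 (hB c)).
have {}rR : eigen N' q (rhoT N R) predT r.
  have /memv_imgP[u _ ->] : r \in Rel by apply: vbasis_mem.
  exact: eigen_rhoX.
exists (fun p' : 'I_d.+1 => if p' == p then elementary p w0 r else 0); split.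
- move=> p'; case: eqP => [->|_]; last exact: eigen0.
  move=> l lm /andP[pl lp]; apply: (elementary_eigen w0 _ rR) => //.
- by move=> p'; case: eqP => // ->; rewrite /uncut pd ib.
by rewrite -big_mkcond big_pred1_eq.
Qed.

(** Each eigenvector of an uncut window is expanded in tensors of symmetrized words, and these in
    the basis of [Rel], which leads to the generators [Jgen]. *)
Lemma blockrel_Jrel i f : supported i (component f) ->
  (forall c, blockrel c (component f c)) -> f \in Jrel Rel i d.
Proof.
move=> sf hf; pose emb c (v : TV k n d) := of_components (fun c' => if c' == c then v else 0).
have embP c a u v : emb c (a *: u + v) = a *: emb c u + emb c v.
  by apply/ffunP => x; rewrite !ffunE; case: eqP => _; rewrite !ffunE ?scaler0 ?addr0.
have emb0 c : emb c 0 = 0.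
  by apply/ffunP => x; rewrite !ffunE; case: eqP => _; rewrite !ffunE.
have emb_sum c (I : finType) (F : I -> TV k n d) : emb c (\sum_i F i) = \sum_i emb c (F i).
  apply: (big_morph (emb c)) => // u v.
  by rewrite -[u]scale1r embP !scale1r.
have -> : f = \sum_c emb c (component f c).
  apply/ffunP => -[c w]; rewrite sum_ffunE (bigD1 c) //= !ffunE eqxx ffunE big1 ?addr0 //.
  by move=> c' cc'; rewrite !ffunE eq_sym (negbTE cc') ffunE.
apply: memv_suml => c _.
have [vc|vc] := boolP (validc i c); last by rewrite sf // emb0 mem0v.
have [x [x1 x2 ->]] := hf c; rewrite emb_sum.
apply: memv_suml => p _; have [up|up] := boolP (uncut N' c p); last by rewrite x2 // emb0 mem0v.
apply: (subvP (sumv_sup c vc (subvv _))).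
apply: (subvP (sumv_sup p up (subvv _))).
have [pd _] := uncutP _ _ _ up.
rewrite [x p](window_eigen_elementary hTN hq pd); last first.
  by move=> l pl lp; apply: x1; [lia | rewrite /window_pred inE pl].
rewrite emb_sum; apply: memv_suml => w0 _.
apply: (subvP (sumv_sup w0 isT (subvv _))).
rewrite -[_ *: elementary _ _ _]addr0 embP emb0 addr0 memvZ //.
have rR : rhoX N q R (deltaS k N (window p N w0)) \in Rel by apply: memv_img; exact: memvf.
rewrite (coord_vbasis rR).
pose J (r : TV k n N) := emb c (elementary p w0 r).
have JE r : J r = Jgen c p w0 r.
  by apply: componentsP => c'; rewrite of_componentsK component_Jgen.
have el a (r r' : TV k n N) : elementary p w0 (a *: r + r') = a *: elementary p w0 r + elementary p w0 r'.
  apply/ffunP => w; rewrite !ffunE; case: ifP => _; last by rewrite scaler0 addr0.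
  exact: coordS_linear.
have J0 : J 0 = 0.
  have := el (-1) 0 0; rewrite scaleN1r oppr0 addr0 scaleN1r addNr /J => ->; exact: emb0.
have J_sum (I : finType) (F : I -> TV k n N) : J (\sum_i F i) = \sum_i J (F i).
  by apply: (big_morph J) => // u v; rewrite /J -[u]scale1r el embP !scale1r.
rewrite -/(J _) J_sum; apply: memv_suml => j _.
have -> : J (coord (vbasis Rel) j (rhoX N q R (deltaS k N (window p N w0))) *: (vbasis Rel)`_j) =
   coord (vbasis Rel) j (rhoX N q R (deltaS k N (window p N w0))) *: J (vbasis Rel)`_j.
  by rewrite -[X in J X]addr0 /J el embP -/(J _) -/(J 0) J0 addr0.
rewrite memvZ // JE.
have bj : (vbasis Rel)`_j \in (vbasis Rel : seq _) by rewrite mem_nth ?size_tuple.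
by rewrite (big_rem _ bj) /=; apply: (subvP (addvSl _ _)); apply: memv_line.
Qed.

Lemma cyc_sub_bnd i : (0 < i)%N -> d != nuN N i -> (cyc Rel i d <= bnd Rel i d)%VS.
Proof.
move=> i0 di; apply/subvP => f; rewrite memv_cap => /andP[/mem_Ch sf].
rewrite -memv_preim => hf.
have cf : bar_cycle blockrel (component f).
  by move=> c; rewrite -component_barD; apply: Jrel_blockrel hf.
have [psi sp hp] := bar_acyclic q0 hq hTd N'_gt0 di sf cf.
pose g := of_components psi.
have gE c : component g c = psi c by exact: of_componentsK.
have barg c : bar (component g) c = bar psi c by apply: eq_bigr => b _; rewrite gE.
have gC : g \in Ch k n i.+1 d by apply/mem_Ch => c vc; rewrite gE sp.
rewrite -[f](subrK (barD k n d g)) addrC; apply: memv_add; first exact: memv_img.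
have fE c : component (f - barD k n d g) c = component f c - bar psi c.
  by rewrite addrC -scaleN1r componentP component_barD barg scaleN1r addrC.
apply: blockrel_Jrel => c; last by rewrite fE; apply: hp.
by move=> vc; rewrite fE sf // (supported_bar sp) // subr0.
Qed.

End Glue.

Theorem theorem4p1 (k : fieldType) (n0 n1 N : nat) (q : k)
    (R : 'End(TV k (n0 + n1) 2)) :
  (2%:R : k) != 0 ->
  (2 <= N)%N ->
  q != 0 ->
  (forall m : nat, (0 < m)%N -> qint q m != 0) ->
  hecke_op n0 q R ->
  NKoszul (relX N q R).
Proof.
move=> _; case: N => [//|N'] N2 q0 hq hR i d di.
have triv : (forall c : {set 'I_d}, ~~ validc i c) -> torDim (relX N'.+1 q R) i d = 0%N.
  move=> nv; rewrite /torDim /cyc /Ch big_pred0 => [|x]; last exact/negbTE/nv.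
  by rewrite cap0v dimv0.
case: d di triv => [|m] di triv.
  (* In internal degree 0 the only cut set is empty, so the bar degree would be 0, and nu_N(0) =
     0. *)
  apply: triv => c; apply/negP => /andP[/eqP ci _].
  case/negP: di; rewrite /nuN (_ : i = 0%N) //.
  by rewrite -ci; apply/eqP; rewrite cards_eq0; apply/eqP/setP => -[].
case: i di triv => [|i] di triv.
  (* In positive internal degree a valid cut set contains 0, so there are no chains of bar degree
     0. *)
  apply: triv => c; apply/negP => /andP[]; rewrite cards_eq0 => /eqP -> /forallP/(_ ord0).
  by rewrite inE.
(* [torDim] is a truncated difference, which vanishes once every cycle is a boundary. *)
apply/eqP; rewrite subn_eq0; apply: dimvS; apply: cyc_sub_bnd => //.
  exact: rhoT_hecke hR.
exact: rhoT_hecke hR.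
Qed.
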